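(* Consider the stochastic sub-gradient diffusion algorithm $$\boldsymbol{\psi}_{k,i}=\boldsymbol{w}_{k,i-1}-\mu_k\,\widehat g_k(\boldsymbol{w}_{k,i-1}),\qquad \boldsymbol{w}_{k,i}=\sum_{\ell\in\mathcal N_k}a_{\ell k}\boldsymbol{\psi}_{\ell,i},\qquad k=1,\dots,N,\ i\ge 1,$$ used to seek the unique minimizer $w^\star$ of $\min_{w\in\mathbb R^M}\sum_{k=1}^N q_kJ_k(w)$, with the network, step-sizes $\mu_k=(q_k/p_k)\mu_o$, risks $J_k$ and gradient noise satisfying all the assumptions listed in the context, with parameters $\{\eta_k,\beta_k^2,\sigma_k^2,e_k^2,f_k^2\}$. Then there exists a constant $h\ge 0$, not depending on $i$ or on $\mu_o$, such that the following holds whenever the step-sizes are small enough that, for every $k=1,\dots,N$, $$0<\mu_k<\min\left\{\frac1{\eta_k},\ \frac{\eta_kq_k}{p_k\beta_k^2+(1+2h)p_ke_k^2}\right\}.$$ The constant $h$ is a bound on the asymptotic network disagreement: there is an $I_o$ such that $$\mathbb E\,\Big\|\sum_{\ell=1}^N p_\ell(w^\star-\boldsymbol{w}_{\ell,i-1})-(w^\star-\boldsymbol{w}_{k,i-1})\Big\|^2\le h^2\mu_o^2\qquad\text{for all } i\ge I_o \text{ and all } k.$$ Moreover, the number $$\alpha=\max_{1\le k\le N}\left\{1-\mu_k\big(\eta_k-\mu_oe_k^2-\mu_o\beta_k^2-2\mu_oh\,e_k^2\big)\right\}=1-O(\mu_o)$$ lies in $(0,1)$, and there is a constant $\xi$ independent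 of $i$ such that for all $i\ge1$ $$\mathbb E\Big(\sum_{k=1}^Nq_kJ_k(\boldsymbol{w}^{\rm best}_{k,i})-\sum_{k=1}^Nq_kJ_k(w^\star)\Big)\le \xi\,\alpha^i\sum_{k=1}^Nq_k\,\mathbb E\|\boldsymbol{w}_{k,0}-w^\star\|^2+\frac{\mu_o}{2}\sum_{k=1}^N\Big(q_kf_k^2+q_k\sigma_k^2+2hq_k\Big[f_k^2+\|g_k'(w^\star)\|^2+\frac12\Big]\Big).$$ That is, $\mathbb E\sum_kq_kJ_k(\boldsymbol{w}_{k,i}^{\rm best})$ converges to an $O(\mu_o)$-neighborhood of $\sum_kq_kJ_k(w^\star)$ at the exponential rate $O(\alpha^i)$.
   Context: **Network.** There are $N$ agents. $\mathcal N_k$ is the neighborhood of agent $k$ (including $k$). $A=[a_{\ell k}]$ is an $N\times N$ left-stochastic matrix: entries are nonnegative, each column sums to one, and $a_{\ell k}=0$ if $\ell\notin\mathcal N_k$. The network is strongly connected: any two distinct agents are linked in both directions by paths with nonzero weights, and $a_{kk}>0$ for at least one $k$; hence $A$ is primitive. $p=(p_1,\dots,p_N)^{\mathsf T}$ is its Perron vector: $Ap=p$, $p_k>0$, $\sum_kp_k=1$. **Weights and step-sizes.** $q_k>0$, $\sum_{k}q_k=1$. The constant step-sizes are $\mu_k=(q_k/p_k)\mu_o$ with $\mu_o>0$, so that $\sum_k p_k\mu_k=\mu_o$. **Risks.** $J_k:\mathbb R^M\to\mathbb R$ is $J_k(w)=\mathbb E\,Q_k(w;\boldsymbol{x}_k)$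 for a convex loss $Q_k$ and random data $\boldsymbol{x}_k$. $J_k$ is possibly non-differentiable. $\partial J_k(w)$ denotes its set of subgradients at $w$, and $g_k(w)\in\partial J_k(w)$ denotes a (true) subgradient. Assumptions, for each $k$: 1. (Strong convexity) with $\eta_k>0$: $J_k(w_1)\ge J_k(w_2)+g_k(w_2)^{\mathsf T}(w_1-w_2)+\frac{\eta_k}{2}\|w_1-w_2\|^2$ for all $w_1,w_2$ (and any subgradient at $w_2$). 2. (Affine-Lipschitz subgradients) there are constants $e_k^2,f_k^2\ge0$ with $\|g_k(w_1)-g_k'(w_2)\|^2\le e_k^2\|w_1-w_2\|^2+f_k^2$ for all $w_1,w_2$ and any subgradients $g_k(w_1)\in\partial J_k(w_1)$, $g_k'(w_2)\in\partial J_k(w_2)$. (This is implied by $\|g_k(w_1)-g_k'(w_2)\|\le c_k\|w_1-w_2\|+d_k$ with $c_k,d_k\ge 0$.) **Gradient noise.** $\widehat g_k(\boldsymbol{w}_{k,i-1})$ is a random approximation of $g_k(\boldsymbol{w}_{k,i-1})$ computed from the data at time $i$, and $\boldsymbol{s}_{k,i}(\boldsymbol{w}_{k,i-1})=\widehat g_k(\boldsymbol{w}_{k,i-1})-g_k(\boldsymbol{w}_{k,i-1})$. With $\boldsymbol{\mathcal F}_{i-1}$ the filtration generated by all past iterates $\{\boldsymbol{w}_{k,j}: j\le i-1,\ 1\le k\le N\}$, $$\mathbb E[\boldsymbol{s}_{k,i}(\boldsymbol{w}_{k,i-1})\mid\boldsymbol{\mathcal F}_{i-1}]=0,\qquad \mathbb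 E[\|\boldsymbol{s}_{k,i}(\boldsymbol{w}_{k,i-1})\|^2\mid\boldsymbol{\mathcal F}_{i-1}]\le\beta_k^2\|w^\star-\boldsymbol{w}_{k,i-1}\|^2+\sigma_k^2$$ for constants $\beta_k^2,\sigma_k^2\ge0$. The noise processes are independent across agents. The initial iterates satisfy $\mathbb E\|\boldsymbol{w}_{k,0}-w^\star\|^2<\infty$. **Subgradients at $w^\star$.** $g_k'(w^\star)\in\partial J_k(w^\star)$, $k=1,\dots,N$, are subgradients chosen so that $\sum_kq_kg_k'(w^\star)=0$; these exist since $w^\star$ minimizes $\sum_kq_kJ_k$. **Best pocket iterate.** $\boldsymbol{w}^{\rm best}_{k,i}$ is the iterate among $\boldsymbol{w}_{k,1},\dots,\boldsymbol{w}_{k,i}$ with the smallest mean risk, so that $\mathbb E J_k(\boldsymbol{w}_{k,i}^{\rm best})=\min_{1\le j\le i}\mathbb E J_k(\boldsymbol{w}_{k,j})$. $\|\cdot\|$ is the Euclidean norm. *)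

(* Defs.v *)
From HB Require Import structures.
From mathcomp Require Import all_boot all_order all_algebra.
From mathcomp Require Import all_classical all_reals all_analysis.

Set Implicit Arguments.
Unset Strict Implicit.
Unset Printing Implicit Defensive.
Import Order.TTheory GRing.Theory Num.Theory.
Import numFieldNormedType.Exports.

Local Open Scope classical_set_scope.
Local Open Scope ring_scope.

(* The library norm on matrices is the sup norm, hence the explicit Euclidean
   inner product and norm. *)
Definition dotv (R : realType) (M : nat) (u v : 'cV[R]_M) : R :=
  \sum_(j < M) u j 0 * v j 0.

Definition enorm (R : realType) (M : nat) (v : 'cV[R]_M) : R :=
  Num.sqrt (dotv v v).

(* R^M with its Borel sigma-algebra, presented as the product one. *)
Definition mvec (R : realType) (M : nat) : Type :=
  g_sigma_algebraType
    (g_sigma_preimage (fun (j : 'I_M) (v : 'cV[R]_M) => v j 0 : R)).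

Definition subdifferential (R : realType) (M : nat) (J : 'cV[R]_M -> R)
    (w : 'cV[R]_M) : set 'cV[R]_M :=
  [set g | forall v, J v >= J w + dotv g (v - w)].

Definition strongly_convex (R : realType) (M : nat) (J : 'cV[R]_M -> R)
    (eta : R) : Prop :=
  forall w1 w2 g, subdifferential J w2 g ->
    J w1 >= J w2 + dotv g (w1 - w2) + eta / 2 * enorm (w1 - w2) ^+ 2.

Definition affine_lipschitz (R : realType) (M : nat) (J : 'cV[R]_M -> R)
    (e f : R) : Prop :=
  forall w1 w2 g1 g2, subdifferential J w1 g1 -> subdifferential J w2 g2 ->
    enorm (g1 - g2) ^+ 2 <= e ^+ 2 * enorm (w1 - w2) ^+ 2 + f ^+ 2.

Definition is_unique_minimizer (R : realType) (M : nat) (F : 'cV[R]_M -> R)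
    (w : 'cV[R]_M) : Prop :=
  (forall v, F w <= F v) /\
  (forall v, (forall u, F v <= F u) -> v = w).

(* [A l k] is the weight with which agent [k] scales what it receives from
   agent [l]; [nbh k] is the neighborhood of [k]. *)
Definition left_stochastic (R : realType) (N : nat)
    (nbh : 'I_N -> {set 'I_N}) (A : 'M[R]_N) : Prop :=
  [/\ forall k, k \in nbh k,
      forall l k, 0 <= A l k,
      forall k, \sum_(l < N) A l k = 1 &
      forall l k, l \notin nbh k -> A l k = 0].

Definition strongly_connected (R : realType) (N : nat) (A : 'M[R]_N) : Prop :=
  (forall l k, l != k -> connect (fun a b => A a b != 0) l k) /\
  (exists k, 0 < A k k).

Definition perron_vector (R : realType) (N : nat) (A : 'M[R]_N)
    (p : 'cV[R]_N) : Prop :=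
  [/\ A *m p = p, forall k, 0 < p k 0 & \sum_(k < N) p k 0 = 1].

Definition step_size (R : realType) (N : nat) (p : 'cV[R]_N) (q : 'I_N -> R)
    (muo : R) (k : 'I_N) : R := q k / p k 0 * muo.

(* [ghat k w z] is the approximate subgradient formed by agent [k] at the point
   [w] from an observation [z]; at time [i] the observation is [y k i], so that
   the step from time [n] to time [n.+1] uses [y k n.+1]. *)
Fixpoint diffusion (R : realType) (N M : nat) (Omega : Type)
    (Y : 'I_N -> Type) (nbh : 'I_N -> {set 'I_N}) (A : 'M[R]_N)
    (mu : 'I_N -> R) (ghat : forall k, 'cV[R]_M -> Y k -> 'cV[R]_M)
    (y : forall k, nat -> Omega -> Y k) (w0 : 'I_N -> Omega -> 'cV[R]_M)
    (i : nat) : 'I_N -> Omega -> 'cV[R]_M :=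
  match i with
  | 0%N => w0
  | n.+1 =>
      let w := diffusion nbh A mu ghat y w0 n in
      fun k omega =>
        \sum_(l in nbh k)
          A l k *: (w l omega - mu l *: ghat l (w l omega) (y l n.+1 omega))
  end.

Definition gradient_noise (R : realType) (N M : nat) (Omega : Type)
    (Y : 'I_N -> Type) (ghat : forall k, 'cV[R]_M -> Y k -> 'cV[R]_M)
    (g : 'I_N -> 'cV[R]_M -> 'cV[R]_M) (y : forall k, nat -> Omega -> Y k)
    (k : 'I_N) (i : nat) (w : 'cV[R]_M) (omega : Omega) : 'cV[R]_M :=
  ghat k w (y k i omega) - g k w.

(* [Y] is a version of the conditional expectation of [X] given the
   sigma-algebra [G]. *)
Definition is_cond_exp d (Omega : measurableType d) (R : realType)
    (P : probability Omega R) (G : set (set Omega)) (X Y : Omega -> R) : Prop :=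
  [/\ P.-integrable setT (EFin \o X),
      P.-integrable setT (EFin \o Y),
      forall B : set R, measurable B -> G (Y @^-1` B) &
      forall E, G E ->
        (\int[P]_(omega in E) (X omega)%:E =
         \int[P]_(omega in E) (Y omega)%:E)%E].

Definition past (R : realType) (N M : nat) (Omega : Type)
    (w : nat -> 'I_N -> Omega -> 'cV[R]_M) (n : nat) : set (set Omega) :=
  <<s [set E | exists j k (B : set (mvec R M)),
        [/\ (j <= n)%N, measurable B & E = w j k @^-1` B]] >>.

Definition noise_moments d (Omega : measurableType d) (R : realType)
    (P : probability Omega R) (N M : nat)
    (s : 'I_N -> nat -> 'cV[R]_M -> Omega -> 'cV[R]_M)
    (w : nat -> 'I_N -> Omega -> 'cV[R]_M) (wstar : 'cV[R]_M)
    (beta sigma : 'I_N -> R) : Prop :=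
  forall k n,
    (forall j : 'I_M,
       is_cond_exp P (past w n)
         (fun omega => s k n.+1 (w n k omega) omega j 0) (fun=> 0)) /\
    (exists2 V : Omega -> R,
       is_cond_exp P (past w n)
         (fun omega => enorm (s k n.+1 (w n k omega) omega) ^+ 2) V &
       {ae P, forall omega,
         V omega <= beta k ^+ 2 * enorm (wstar - w n k omega) ^+ 2
                    + sigma k ^+ 2}).

(* The noise process of agent [k] is the random field [s k i v], [i >= 1],
   [v] in R^M: along the iterates, which the network couples, the noise values
   of different agents share a dependence on the past. *)
Definition noise_sigma_algebra (R : realType) (N M : nat) (Omega : Type)
    (s : 'I_N -> nat -> 'cV[R]_M -> Omega -> 'cV[R]_M) (k : 'I_N) :
    set (set Omega) :=
  <<s [set E | exists i v (B : set (mvec R M)),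
        [/\ (0 < i)%N, measurable B & E = s k i v @^-1` B]] >>.

Definition independent_across_agents d (Omega : measurableType d)
    (R : realType) (P : probability Omega R) (N M : nat)
    (s : 'I_N -> nat -> 'cV[R]_M -> Omega -> 'cV[R]_M) : Prop :=
  forall (D : {set 'I_N}) (E : 'I_N -> set Omega),
    (forall k, k \in D -> noise_sigma_algebra s k (E k)) ->
    P (\bigcap_(k in [set` D]) E k) = (\prod_(k in D) P (E k))%E.

(* [best k i] is the time index at which the best pocket iterate of agent [k]
   up to time [i] is attained. *)
Definition is_best_pocket d (Omega : measurableType d) (R : realType)
    (P : probability Omega R) (N M : nat) (J : 'I_N -> 'cV[R]_M -> R)
    (w : nat -> 'I_N -> Omega -> 'cV[R]_M) (best : 'I_N -> nat -> nat) : Prop :=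
  forall k i, (0 < i)%N ->
    (0 < best k i <= i)%N /\
    (forall j, (0 < j <= i)%N ->
      ('E_P[fun omega => J k (w (best k i) k omega)] <=
       'E_P[fun omega => J k (w j k omega)])%E).

Definition small_steps (R : realType) (N : nat) (p : 'cV[R]_N)
    (q eta beta e : 'I_N -> R) (h muo : R) : Prop :=
  forall k,
    0 < step_size p q muo k <
      Num.min (1 / eta k)
        (eta k * q k /
         (p k 0 * beta k ^+ 2 + (1 + 2 * h) * p k 0 * e k ^+ 2)).

(* For small steps every term of the maximum is positive, as
   [step_size p q muo k < 1 / eta k], so the seed 0 is harmless. *)
Definition rate (R : realType) (N : nat) (p : 'cV[R]_N)
    (q eta beta e : 'I_N -> R) (h muo : R) : R :=
  \big[Num.max/0]_(k < N)
    (1 - step_size p q muo k *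
         (eta k - muo * e k ^+ 2 - muo * beta k ^+ 2
          - 2 * muo * h * e k ^+ 2)).

(* Main.v *)
Require Import Defs.
From HB Require Import structures.
From mathcomp Require Import all_boot all_order all_algebra.
From mathcomp Require Import all_classical all_reals all_analysis.
From mathcomp Require Import measurable_realfun ring lra zify.

Set Implicit Arguments.
Unset Strict Implicit.
Unset Printing Implicit Defensive.
Import Order.TTheory GRing.Theory Num.Theory.
Import numFieldNormedType.Exports.

Local Open Scope classical_set_scope.
Local Open Scope ring_scope.

(** The weighted mean-square deviation [S n], the sum over [k] of
    [p k 0 * E (sqn (w n k - wstar))], obeys the recursion of the subgradient
    method. By Jensen's inequality and [A *m p = p] the combination step does not
    increase it. In the gradient step the noise is orthogonal to the current
    error, which is a function of the past (centered_orthogonal), and strong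
    convexity turns the remaining inner product into the gap
    [J k (w n k) - J k wstar] of each agent at its own iterate (mean_descent).
    With [p k 0 * mu k = q k * muo] this gives
    [S n.+1 <= alpha * S n - 2 * muo * D n + muo ^+ 2 * B], where [D n] is the
    mean of the weighted sum of the gaps (total_msd_step, recursion_rate). The
    best pocket iterates have, agent by agent, at most these mean gaps. Since
    [0 <= S n] for all [n], the best gap cannot stay above [muo * B / 2] by more
    than a multiple of [alpha ^+ i] (pocket_bound). When the network starts at
    [wstar] no such multiple is available and the first iterate is estimated
    directly (pocket_bound_from_optimum).

    The constant [h] occurs in the step-size condition, in the rate and in the
    residual, each time so that a larger [h] leaves more room. The affine
    Lipschitz bound on a strongly convex risk forces [e k] to dominate [eta k]
    (strong_convexity_le_lipschitz), so the term [2 * h * e k ^+ 2] of the rate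
    covers the growth of the second moment of the approximate subgradients once
    [h] is large, and the residual term [h] covers their offset.

    For the disagreement, a power of [A] is positive because the network is
    strongly connected with a self-loop (primitive_exp_mx), and hence contracts
    deviations from the centroid by Doeblin's argument (doeblin_contraction).
    Between two such contractions the gradient steps add an energy of order
    [muo ^+ 2] times the second moments of the approximate subgradients. These are
    eventually bounded by a constant free of [muo] and [h]
    (recursion_eventually_bounded), which is why [h] can be chosen first. *)

(** * Euclidean geometry *)

Section Euclidean.
Variables (R : realType) (M : nat).
Implicit Types (u v w : 'cV[R]_M).

Definition sqn u : R := dotv u u.

Lemma dotvC u v : dotv u v = dotv v u.
Proof. by apply: eq_bigr => j _; rewrite mulrC. Qed.

Lemma dotvDl u v w : dotv (u + v) w = dotv u w + dotv v w.
Proof. by rewrite -big_split; apply: eq_bigr => j _; rewrite mxE mulrDl. Qed.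

Lemma dotvZl a u v : dotv (a *: u) v = a * dotv u v.
Proof. by rewrite /dotv mulr_sumr; apply: eq_bigr => j _; rewrite mxE mulrA. Qed.

Lemma dotvNl u v : dotv (- u) v = - dotv u v.
Proof. by rewrite -scaleN1r dotvZl mulN1r. Qed.

Lemma dotvDr u v w : dotv u (v + w) = dotv u v + dotv u w.
Proof. by rewrite dotvC dotvDl !(dotvC u). Qed.

Lemma dotvZr a u v : dotv u (a *: v) = a * dotv u v.
Proof. by rewrite dotvC dotvZl dotvC. Qed.

Lemma dotvNr u v : dotv u (- v) = - dotv u v.
Proof. by rewrite dotvC dotvNl dotvC. Qed.

Lemma dotv_suml (I : finType) (F : I -> 'cV[R]_M) v :
  dotv (\sum_i F i) v = \sum_i dotv (F i) v.
Proof.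
rewrite /dotv exchange_big /=; apply: eq_bigr => j _.
by rewrite summxE mulr_suml.
Qed.

Lemma dotv_sumr (I : finType) (F : I -> 'cV[R]_M) v :
  dotv v (\sum_i F i) = \sum_i dotv v (F i).
Proof. by rewrite dotvC dotv_suml; apply: eq_bigr => i _; rewrite dotvC. Qed.

Lemma sqn_ge0 u : 0 <= sqn u.
Proof. by apply: sumr_ge0 => j _; rewrite -expr2 sqr_ge0. Qed.

Lemma sqn0 : sqn 0 = 0.
Proof. by rewrite /sqn /dotv big1 // => j _; rewrite mxE mul0r. Qed.

Lemma enorm_sqr u : enorm u ^+ 2 = sqn u.
Proof. by rewrite sqr_sqrtr // sqn_ge0. Qed.

Lemma sqnN u : sqn (- u) = sqn u.
Proof. by rewrite /sqn dotvNl dotvNr opprK. Qed.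

Lemma sqnC u v : sqn (u - v) = sqn (v - u).
Proof. by rewrite -sqnN opprB. Qed.

Lemma sqnZ a u : sqn (a *: u) = a ^+ 2 * sqn u.
Proof. by rewrite /sqn dotvZl dotvZr mulrA. Qed.

Lemma sqnD u v : sqn (u + v) = sqn u + 2 * dotv u v + sqn v.
Proof. by rewrite /sqn dotvDl !dotvDr (dotvC v u); ring. Qed.

Lemma dotv_young (t : R) u v : 0 < t ->
  2 * dotv u v <= t * sqn u + t^-1 * sqn v.
Proof.
move=> t0; have := sqn_ge0 (t *: u - v).
rewrite sqnD sqnZ sqnN dotvZl dotvNr => H.
have {}H : 0 <= t^-1 * (t ^+ 2 * sqn u + 2 * (t * - dotv u v) + sqn v).
  by rewrite mulr_ge0 // invr_ge0 ltW.
rewrite -subr_ge0; apply: le_trans H _; rewrite le_eqVlt; apply/orP; left.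
by apply/eqP; field; rewrite gt_eqF.
Qed.

Lemma sqnD_le_weighted (t : R) u v : 0 < t ->
  sqn (u + v) <= (1 + t) * sqn u + (1 + t^-1) * sqn v.
Proof. by move=> t0; have := dotv_young u v t0; rewrite sqnD; lra. Qed.

Lemma sqnD_le u v : sqn (u + v) <= 2 * sqn u + 2 * sqn v.
Proof. by have := @sqnD_le_weighted 1 u v ltr01; rewrite invr1; lra. Qed.

(** Expanding [\sum_i \sum_j c i * c j * sqn (v i - v j) >= 0] gives Jensen's
    inequality without dividing by the total weight. *)
Lemma sqn_jensen (I : finType) (c : I -> R) (v : I -> 'cV[R]_M) :
  (forall i, 0 <= c i) ->
  sqn (\sum_i c i *: v i) <= (\sum_i c i) * \sum_i c i * sqn (v i).
Proof.
move=> c0.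
have H : 0 <= \sum_i \sum_j c i * c j * sqn (v i - v j).
  by apply: sumr_ge0 => i _; apply: sumr_ge0 => j _; rewrite !mulr_ge0 ?sqn_ge0.
suff E : \sum_i \sum_j c i * c j * sqn (v i - v j) =
    2 * ((\sum_i c i) * (\sum_i c i * sqn (v i)) - sqn (\sum_i c i *: v i)).
  by move: H; rewrite E pmulr_rge0 // subr_ge0.
have -> : \sum_i \sum_j c i * c j * sqn (v i - v j) =
    \sum_i (c i * (\sum_j c j * sqn (v j)) + (\sum_j c j) * (c i * sqn (v i))
      - 2 * (c i * dotv (v i) (\sum_j c j *: v j))).
  apply: eq_bigr => i _.
  transitivity (\sum_j (c i * (c j * sqn (v j)) + c j * (c i * sqn (v i))
      - 2 * (c i * dotv (v i) (c j *: v j)))).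
    by apply: eq_bigr => j _; rewrite sqnD sqnN dotvNr dotvZr; ring.
  by rewrite sumrB big_split /= -!mulr_sumr -mulr_suml -dotv_sumr.
rewrite sumrB big_split /= -!mulr_sumr -mulr_suml /sqn dotv_suml.
have -> : \sum_i dotv (c i *: v i) (\sum_j c j *: v j) =
   \sum_i c i * dotv (v i) (\sum_j c j *: v j).
  by apply: eq_bigr => i _; rewrite dotvZl.
ring.
Qed.

End Euclidean.

(** * Mixing by a left-stochastic matrix *)

Section Mixing.
Variables (R : realType) (N M : nat).
Implicit Types (B : 'M[R]_N) (p : 'cV[R]_N) (W : 'I_N -> 'cV[R]_M).

Definition mix B W (k : 'I_N) : 'cV[R]_M := \sum_l B l k *: W l.

(** With the Perron vector as weight, this quadratic form does not increase in a
    mixing step. *)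
Definition energy p W : R := \sum_k p k 0 * sqn (W k).

Definition centroid p W : 'cV[R]_M := \sum_l p l 0 *: W l.

Definition deviation p W (k : 'I_N) : 'cV[R]_M := centroid p W - W k.

Lemma energy_ge0 p W : (forall k, 0 <= p k 0) -> 0 <= energy p W.
Proof. by move=> p0; apply: sumr_ge0 => k _; rewrite mulr_ge0 ?sqn_ge0. Qed.

Lemma mixM B C W : mix (B *m C) W = mix C (mix B W).
Proof.
apply/funext => k; rewrite /mix.
under eq_bigr do rewrite mxE scaler_suml.
rewrite exchange_big /=; apply: eq_bigr => j _.
by rewrite scaler_sumr; apply: eq_bigr => l _; rewrite scalerA mulrC.
Qed.

Lemma mix1 W : mix 1%:M W = W.
Proof.
apply/funext => k; rewrite /mix (bigD1 k) //= mxE eqxx scale1r big1 ?addr0 //.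
by move=> l lk; rewrite mxE (negbTE lk) scale0r.
Qed.

Lemma mixB B U W : mix B (fun k => U k - W k) = fun k => mix B U k - mix B W k.
Proof.
apply/funext => k; rewrite /mix /= -sumrB.
by apply: eq_bigr => l _; rewrite scalerBr.
Qed.

Lemma deviationB p U W :
  deviation p (fun k => U k - W k) = fun k => deviation p U k - deviation p W k.
Proof.
apply/funext => k; rewrite /deviation /centroid.
under eq_bigr do rewrite scalerBr.
rewrite sumrB; by rewrite !opprD !opprK addrACA.
Qed.

Lemma deviation_shift p W v k : \sum_l p l 0 = 1 ->
  \sum_l p l 0 *: (v - W l) - (v - W k) = - deviation p W k.
Proof.
move=> p1; under eq_bigr do rewrite scalerBr.
rewrite sumrB -scaler_suml p1 scale1r /deviation -/(centroid p W).
by rewrite !opprB addrC addrA subrK.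
Qed.

Lemma perron_sum B p l : B *m p = p -> \sum_k B l k * p k 0 = p l 0.
Proof. by move=> Bp; rewrite -[in RHS]Bp mxE. Qed.

Lemma centroid_mix B p W : B *m p = p -> centroid p (mix B W) = centroid p W.
Proof.
move=> Bp; rewrite /centroid /mix.
under eq_bigr do rewrite scaler_sumr.
rewrite exchange_big /=; apply: eq_bigr => l _.
rewrite -(perron_sum l Bp) scaler_suml; apply: eq_bigr => k _.
by rewrite scalerA mulrC.
Qed.

Lemma energyD_le (t : R) p U W : (forall k, 0 <= p k 0) -> 0 < t ->
  energy p (U \+ W) <= (1 + t) * energy p U + (1 + t^-1) * energy p W.
Proof.
move=> p0 t0; rewrite /energy !mulr_sumr -big_split /=; apply: ler_sum => k _.
have := ler_wpM2l (p0 k) (sqnD_le_weighted (U k) (W k) t0); lra.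
Qed.

(** Jensen's inequality in every column; exchanging the two sums collects the
    weights into [B *m p], which the eigenvector property then simplifies. *)
Lemma energy_mix_le (c : R) B p W :
  (forall k, 0 <= p k 0) -> (forall l k, 0 <= B l k) ->
  (forall k, \sum_l B l k = c) ->
  energy p (mix B W) <= c * \sum_l (B *m p) l 0 * sqn (W l).
Proof.
move=> p0 B0 Bc.
have H k : p k 0 * sqn (mix B W k) <= p k 0 * (c * \sum_l B l k * sqn (W l)).
  by rewrite ler_wpM2l // -(Bc k); apply: sqn_jensen.
apply: le_trans (ler_sum _ (fun k _ => H k)) _.
under eq_bigr do rewrite mulrCA mulr_sumr.
rewrite -mulr_sumr exchange_big /= le_eqVlt; apply/orP; left; apply/eqP.
congr (_ * _); apply: eq_bigr => l _; rewrite mxE mulr_suml.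
by apply: eq_bigr => k _; ring.
Qed.

Lemma energy_mix B p W :
  (forall k, 0 <= p k 0) -> (forall l k, 0 <= B l k) ->
  (forall k, \sum_l B l k = 1) -> B *m p = p ->
  energy p (mix B W) <= energy p W.
Proof.
move=> p0 B0 B1 Bp; have := energy_mix_le W p0 B0 B1.
by rewrite Bp mul1r.
Qed.

Lemma energy_deviation p W : (forall k, 0 <= p k 0) -> \sum_k p k 0 = 1 ->
  energy p (deviation p W) <= energy p W.
Proof.
move=> p0 p1; suff -> : energy p (deviation p W) =
    energy p W - sqn (centroid p W).
  by have := sqn_ge0 (centroid p W); lra.
have -> : energy p (deviation p W) = \sum_k (p k 0 * sqn (centroid p W)
   - 2 * dotv (p k 0 *: W k) (centroid p W) + p k 0 * sqn (W k)).
  apply: eq_bigr => k _.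
  by rewrite /deviation sqnD sqnN dotvNr dotvZl dotvC; ring.
rewrite big_split sumrB /= -mulr_suml p1 mul1r -mulr_sumr -dotv_suml.
rewrite -/(centroid p W) -/(energy p W) /sqn; ring.
Qed.

Lemma deviation_le p W k : (forall k, 0 <= p k 0) ->
  p k 0 * sqn (deviation p W k) <= energy p (deviation p W).
Proof.
move=> p0; rewrite /energy (bigD1 k) //= lerDl.
by apply: sumr_ge0 => l _; rewrite mulr_ge0 ?sqn_ge0.
Qed.

(** Doeblin's argument: subtracting [eps * p] from every column of [B] does not
    change how [B] acts on deviations, since these have a vanishing weighted
    sum, and leaves nonnegative columns of total weight [1 - eps]. *)
Lemma doeblin_contraction (eps : R) B p W :
  (forall k, 0 <= p k 0) -> \sum_k p k 0 = 1 ->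
  (forall l k, eps * p l 0 <= B l k) ->
  (forall k, \sum_l B l k = 1) -> B *m p = p ->
  energy p (deviation p (mix B W)) <=
    (1 - eps) ^+ 2 * energy p (deviation p W).
Proof.
move=> p0 p1 Be B1 Bp.
pose C : 'M[R]_N := \matrix_(l, k) (B l k - eps * p l 0).
have C0 l k : 0 <= C l k by rewrite mxE subr_ge0.
have C1 k : \sum_l C l k = 1 - eps.
  under eq_bigr do rewrite mxE.
  by rewrite sumrB B1 -mulr_sumr p1 mulr1.
have Cp : C *m p = (1 - eps) *: p.
  apply/colP => l; rewrite !mxE.
  under eq_bigr do rewrite mxE mulrBl.
  by rewrite sumrB perron_sum // -mulr_sumr p1 mulr1 mulrBl mul1r.
have p1v : \sum_l p l 0 *: (centroid p W - W l) = 0.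
  under eq_bigr do rewrite scalerBr.
  by rewrite sumrB -scaler_suml p1 scale1r -/(centroid p W) subrr.
have -> : deviation p (mix B W) = mix C (deviation p W).
  apply/funext => k; rewrite /deviation centroid_mix // /mix.
  under [RHS]eq_bigr do rewrite mxE scalerBl -scalerA.
  rewrite sumrB -scaler_sumr p1v scaler0 subr0.
  under [RHS]eq_bigr do rewrite scalerBr.
  by rewrite sumrB -scaler_suml B1 scale1r.
apply: le_trans (energy_mix_le _ p0 C0 C1) _.
rewrite Cp expr2 -mulrA le_eqVlt; apply/orP; left; apply/eqP.
congr (_ * _); rewrite /energy mulr_sumr; apply: eq_bigr => l _.
by rewrite mxE mulrA.
Qed.

End Mixing.

(** * Primitivity of the combination matrix *)

Section Primitivity.
Variables (R : realType) (N : nat) (A : 'M[R]_N).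
Hypothesis A0 : forall l k, 0 <= A l k.

Lemma exp_mx_ge0 n l k : 0 <= (A ^+ n) l k.
Proof.
elim: n l k => [|n IH] l k; first by rewrite expr0 mxE ler0n.
by rewrite exprS -mulmxE mxE sumr_ge0 // => j _; rewrite mulr_ge0.
Qed.

Lemma exp_mx_gt0D a b l j k :
  0 < (A ^+ a) l j -> 0 < (A ^+ b) j k -> 0 < (A ^+ (a + b)) l k.
Proof.
move=> al bk; rewrite exprD -mulmxE mxE (bigD1 j) //=.
rewrite ltr_pwDl ?mulr_gt0 // sumr_ge0 // => i _.
by rewrite mulr_ge0 ?exp_mx_ge0.
Qed.

Lemma connect_exp_mx l k :
  connect (fun a b => A a b != 0) l k -> exists n, 0 < (A ^+ n) l k.
Proof.
case/connectP => s + ->; elim: s l => [|j s IH] l /=.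
  by exists 0; rewrite expr0 mxE eqxx.
case/andP => lj /IH[n jn]; exists n.+1; rewrite -add1n.
by apply: exp_mx_gt0D jn; rewrite expr1 lt0r lj A0.
Qed.

Lemma loop_exp_mx k n : 0 < A k k -> 0 < (A ^+ n) k k.
Proof.
move=> kk; elim: n => [|n IH]; first by rewrite expr0 mxE eqxx.
by rewrite -add1n; apply: exp_mx_gt0D IH; rewrite expr1.
Qed.

(** Walks between different pairs of agents have different lengths; waiting at
    the self-loop equalizes them. *)
Lemma primitive_exp_mx : strongly_connected A ->
  exists m, forall l k, 0 < (A ^+ m.+1) l k.
Proof.
case=> conn [r rr].
have walk l k : exists n, 0 < (A ^+ n) l k.
  apply: connect_exp_mx; have [->|/conn//] := eqVneq l k.
  exact: connect0.
pose a l := projT1 (cid (walk l r)); pose b k := projT1 (cid (walk r k)).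
have aP l : 0 < (A ^+ a l) l r by rewrite /a; case: cid.
have bP k : 0 < (A ^+ b k) r k by rewrite /b; case: cid.
exists (\sum_l a l + \sum_k b k)%N => l k.
rewrite (bigD1 l) //= (bigD1 k (F := b)) //=.
have E x y : (a l + x + (b k + y)).+1 = (a l + (x + y).+1 + b k)%N by lia.
rewrite E.
exact: exp_mx_gt0D (exp_mx_gt0D (aP l) (loop_exp_mx _ rr)) (bP k).
Qed.

Lemma exp_mx_col_sum n k : (forall k, \sum_l A l k = 1) ->
  \sum_l (A ^+ n) l k = 1.
Proof.
move=> A1; elim: n k => [|n IH] k.
  rewrite expr0 (bigD1 k) //= mxE eqxx big1 ?addr0 // => l lk.
  by rewrite mxE (negbTE lk).
rewrite exprS -mulmxE; under eq_bigr do rewrite mxE.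
rewrite exchange_big /= -[RHS](IH k); apply: eq_bigr => j _.
by rewrite -mulr_suml A1 mul1r.
Qed.

Lemma exp_mx_perron n (p : 'cV[R]_N) : A *m p = p -> A ^+ n *m p = p.
Proof.
move=> Ap; elim: n => [|n IH]; first by rewrite expr0 mul1mx.
by rewrite exprS -mulmxE -mulmxA IH.
Qed.

End Primitivity.

Lemma pos_lower_bound (R : realFieldType) (I : finType) (F : I -> R) :
  (forall i, 0 < F i) -> exists2 c : R, 0 < c <= 1 & forall i, c <= F i.
Proof.
move=> F0; exists (\big[Order.min/1]_i F i).
  by rewrite bigmin_le_id andbT; apply/bigmin_gtP; split.
by move=> i; apply: bigmin_le_cond.
Qed.

(** A power of [A] is entrywise positive, and its finitely many entries have a
    common positive lower bound; multiplying that bound by [p l 0 <= 1] gives the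
    form in which Doeblin's argument uses it. *)
Lemma doeblin_minorization (R : realType) (N : nat) (A : 'M[R]_N)
    (p : 'cV[R]_N) :
  (forall l k, 0 <= A l k) -> strongly_connected A ->
  (forall k, 0 < p k 0) -> \sum_k p k 0 = 1 ->
  exists m, exists2 eps : R, 0 < eps <= 1 &
    forall l k, eps * p l 0 <= (A ^+ m.+1) l k.
Proof.
move=> A0 conn p0 p1; have [m mP] := primitive_exp_mx A0 conn.
have [eps e01 eP] := @pos_lower_bound R ('I_N * 'I_N)%type
  (fun lk => (A ^+ m.+1) lk.1 lk.2) (fun lk => mP _ _).
exists m, eps => // l k; apply: le_trans (eP (l, k)).
have e0 : 0 <= eps by case/andP: e01 => /ltW.
rewrite ler_piMr // -p1 (bigD1 l) //= lerDl sumr_ge0 // => i _; exact: ltW.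
Qed.

(** * Scalar recursions *)

(** Along each residue class modulo [m.+1] the distance to the fixed point
    [b / (1 - rho)] shrinks geometrically, and there are finitely many classes. *)
Lemma eventually_le_fixpoint (R : realType) (u : nat -> R) (m n0 : nat)
    (rho b delta : R) :
  0 <= rho < 1 -> 0 < delta ->
  (forall n, (n0 <= n)%N -> u (n + m.+1)%N <= rho * u n + b) ->
  exists n1, forall n, (n1 <= n)%N -> u n <= b / (1 - rho) + delta.
Proof.
case/andP=> r0 r1 d0 ub; set L := b / (1 - rho).
have LE : rho * L + b = L by rewrite /L; field; lra.
have iter n j : (n0 <= n)%N ->
    u (n + j * m.+1)%N - L <= rho ^+ j * (u n - L).
  move=> n0n; elim: j => [|j IH]; first by rewrite addn0 expr0 mul1r.
  have -> : (n + j.+1 * m.+1 = n + j * m.+1 + m.+1)%N by lia.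
  have /ub H : (n0 <= n + j * m.+1)%N by lia.
  have := ler_wpM2l r0 IH; rewrite exprS; lra.
pose C := \sum_(r < m.+1) `|u (n0 + r)%N - L|.
have CP (r : 'I_m.+1) : u (n0 + r)%N - L <= C.
  rewrite /C (bigD1 r) //=; apply: le_trans (ler_norm _) _.
  by rewrite lerDl sumr_ge0.
have [j0 j0P] : exists j0, forall j, (j0 <= j)%N -> rho ^+ j * C <= delta.
  have C0 : 0 <= C by rewrite sumr_ge0.
  have : rho ^+ n @[n --> \oo] --> (0 : R) by apply: cvg_expr; rewrite ger0_norm.
  move/cvgrPdist_lt => /(_ (delta / (1 + C))).
  have dC : 0 < delta / (1 + C) by rewrite divr_gt0 //; lra.
  move=> /(_ dC)[j0 _ H]; exists j0 => j /H.
  rewrite sub0r normrN ger0_norm ?exprn_ge0 // ltr_pdivlMr; last by lra.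
  have := exprn_ge0 j r0; nra.
exists (n0 + j0 * m.+1)%N => n nP.
have rm : ((n - n0) %% m.+1 < m.+1)%N by rewrite ltn_mod.
have En : n = (n0 + (n - n0) %% m.+1 + ((n - n0) %/ m.+1) * m.+1)%N.
  have := divn_eq (n - n0) m.+1; lia.
have /j0P H : (j0 <= (n - n0) %/ m.+1)%N by rewrite leq_divRL //; lia.
have /(iter _ ((n - n0) %/ m.+1)%N) : (n0 <= n0 + (n - n0) %% m.+1)%N by lia.
rewrite -En; have := CP (Ordinal rm) => /=.
have := exprn_ge0 ((n - n0) %/ m.+1)%N r0.
move=> E0 /(ler_wpM2l E0); lra.
Qed.

(** * Strongly convex risks *)

Section StronglyConvex.
Variables (R : realType) (M : nat) (J : 'cV[R]_M -> R) (eta e f : R).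
Hypotheses (eta0 : 0 < eta) (hsc : strongly_convex J eta)
  (hal : affine_lipschitz J e f).
Implicit Types (v w : 'cV[R]_M).

Lemma gap_lower w ws gs : subdifferential J ws gs ->
  dotv gs (w - ws) + eta / 2 * sqn (w - ws) <= J w - J ws.
Proof. by move=> /(hsc w); rewrite enorm_sqr; lra. Qed.

Lemma gap_upper w ws g : subdifferential J w g ->
  J w - J ws <= dotv g (w - ws) - eta / 2 * sqn (w - ws).
Proof.
move=> /(hsc ws); rewrite enorm_sqr (sqnC w) -(opprB w) dotvNr sqnN; lra.
Qed.

Lemma sqn_subgradient_le w ws g gs :
  subdifferential J w g -> subdifferential J ws gs ->
  sqn (g - gs) <= e ^+ 2 * sqn (w - ws) + f ^+ 2.
Proof. by move=> wg wsgs; have := hal wg wsgs; rewrite !enorm_sqr. Qed.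

Section Selection.
Variable g : 'cV[R]_M -> 'cV[R]_M.
Hypothesis hg : forall w, subdifferential J w (g w).

Lemma strong_monotone v w :
  eta ^+ 2 * sqn (v - w) <= sqn (g v - g w).
Proof.
have l := gap_lower v (hg w); have u := gap_upper w (hg v).
have m : eta * sqn (v - w) <= dotv (g v - g w) (v - w).
  by rewrite dotvDl dotvNl; lra.
have ie0 : 0 < eta^-1 by rewrite invr_gt0.
have := dotv_young (g v - g w) (v - w) ie0; rewrite invrK => y.
have {}y : eta * sqn (v - w) <= eta^-1 * sqn (g v - g w) by lra.
have := ler_wpM2l (ltW eta0) y; rewrite mulVKf ?gt_eqF //.
by rewrite mulrA expr2.
Qed.

(** Strong convexity makes the subgradients grow at rate [eta], the affine
    Lipschitz bound lets them grow at rate at most [e]: comparing both far away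
    from the origin, [e] dominates [eta]. In dimension zero nothing relates [e]
    and [eta], hence the factor [sqn v]. *)
Lemma strong_convexity_le_lipschitz v : eta ^+ 2 * sqn v <= e ^+ 2 * sqn v.
Proof.
rewrite leNgt; apply/negP; rewrite -subr_gt0 => c0.
pose c := eta ^+ 2 * sqn v - e ^+ 2 * sqn v.
pose t := 1 + f ^+ 2 / c.
have t1 : 1 <= t by rewrite /t lerDl divr_ge0 ?sqr_ge0 // ltW.
have := le_trans (strong_monotone (t *: v) 0)
  (sqn_subgradient_le (hg (t *: v)) (hg 0)).
rewrite subr0 sqnZ => H.
have {}H : t * (t * c) <= f ^+ 2 by rewrite /c; lra.
have tc : t * c = c + f ^+ 2.
  by rewrite /t mulrDl mul1r divfK // gt_eqF.
have tc0 : 0 <= t * c by rewrite tc addr_ge0 ?sqr_ge0 // ltW.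
have := ler_wpM2r tc0 t1; rewrite mul1r tc; rewrite tc in H.
have : 0 < c by []. lra.
Qed.

Lemma rational_approx v (d : R) : 0 < d ->
  exists r : 'cV[rat]_M, sqn (v - map_mx ratr r) <= d.
Proof.
move=> d0; pose s := Num.min 1 (d / (1 + M%:R)).
have M0 : 0 < 1 + M%:R :> R by rewrite ltr_wpDr.
have s0 : 0 < s by rewrite lt_min ltr01 divr_gt0.
have rj (j : 'I_M) : exists q : rat, `|v j 0 - ratr q| <= s.
  have /rat_in_itvoo[q] : v j 0 - s < v j 0 + s by lra.
  by rewrite in_itv /= => /andP[a b]; exists q; rewrite ler_norml; lra.
exists (\col_j projT1 (cid (rj j))).
have sj (j : 'I_M) : (v - map_mx ratr (\col_j projT1 (cid (rj j)))) j 0 *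
    (v - map_mx ratr (\col_j projT1 (cid (rj j)))) j 0 <= d / (1 + M%:R).
  rewrite !mxE; case: cid => /= q qs; rewrite -expr2 -real_normK ?num_real //.
  have s1 : s <= 1 by rewrite ge_min lexx.
  have sd : s <= d / (1 + M%:R) by rewrite ge_min lexx orbT.
  apply: le_trans sd; have := normr_ge0 (v j 0 - ratr q); nra.
apply: le_trans (ler_sum _ (fun j _ => sj j)) _.
by rewrite sumr_const card_ord -mulrnAl ler_pdivrMr // mulrDr mulr1 mulr_natr
  lerDr ltW.
Qed.

(** A convex function is the supremum of its affine minorants at rational
    points: at a nearby point the minorant is off by a subgradient increment,
    which is bounded, times the distance. *)
Lemma rational_minorant v (c : R) : c < J v ->
  exists r : 'cV[rat]_M,
    c < J (map_mx ratr r) + dotv (g (map_mx ratr r)) (v - map_mx ratr r).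
Proof.
move=> cJ; pose K := e ^+ 2 + f ^+ 2 + 1.
have K0 : 0 < K by rewrite ltr_wpDl ?addr_ge0 ?sqr_ge0.
pose t := Num.min 1 ((J v - c) / K).
have t0 : 0 < t by rewrite lt_min ltr01 divr_gt0 ?subr_gt0.
have t1 : t <= 1 by rewrite ge_min lexx.
have tK : t * K <= J v - c by rewrite -ler_pdivlMr // ge_min lexx orbT.
have [r ru] := rational_approx v (exprn_gt0 2 t0); exists r.
move: (map_mx ratr r) ru => u uv.
have := hg v u => /= l.
have L := sqn_subgradient_le (hg v) (hg u).
have := dotv_young (g v - g u) (v - u) t0; rewrite dotvDl dotvNl => y.
have {l} : J u >= J v - dotv (g v) (v - u) by rewrite -dotvNr opprB.
have e2 : e ^+ 2 * sqn (v - u) <= e ^+ 2.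
  by rewrite ler_piMr ?sqr_ge0 // (le_trans uv) // exprn_ile1 // ltW.
have : t * sqn (g v - g u) <= t * (e ^+ 2 + f ^+ 2).
  by rewrite ler_wpM2l ?(ltW t0) //; lra.
have : t^-1 * sqn (v - u) <= t.
  by rewrite ler_pdivrMl // -expr2.
have : t * (e ^+ 2 + f ^+ 2) + t <= J v - c by move: tK; rewrite /K; lra.
have : t * sqn (g v - g u) <= t * (e ^+ 2 * sqn (v - u) + f ^+ 2).
  by rewrite ler_wpM2l // ltW.
lra.
Qed.

(** A superlevel set of the risk is a countable union of superlevel sets of its
    rational affine minorants. *)
Lemma measurable_risk d (Omega : measurableType d) (W : Omega -> 'cV[R]_M) :
  (forall j, measurable_fun setT (fun omega => W omega j 0)) ->
  measurable_fun setT (J \o W).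
Proof.
move=> mW mD; apply: (measurability _ (RGenOInfty.measurableE R)) => //.
move=> /= _ [_ [c ->] <-]; rewrite setTI preimage_itvoy.
rewrite [X in measurable X](_ : _ = \bigcup_(r : 'cV[rat]_M)
    [set omega | c < J (map_mx ratr r)
       + dotv (g (map_mx ratr r)) (W omega - map_mx ratr r)]).
  apply: countable_bigcupT_measurable => [|r]; first exact: countableP.
  rewrite -preimage_itvoy -[X in measurable X]setTI.
  suff mr : measurable_fun setT (fun omega => J (map_mx ratr r)
     + dotv (g (map_mx ratr r)) (W omega - map_mx ratr r)).
    by apply: mr.
  apply: measurable_funD => //; apply: measurable_sum => j.
  apply: measurable_funM => //.
  under eq_fun do rewrite mxE.
  by apply: measurable_funD.
apply/seteqP; split => omega /=.
  by move=> /rational_minorant[r rP]; exists r.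
case=> r _ /= /lt_le_trans; apply; exact: hg.
Qed.

End Selection.
End StronglyConvex.

(** * Square-integrable random vectors *)

Lemma measurable_mvecP (R : realType) (M : nat) d (T : measurableType d)
    (F : T -> mvec R M) :
  measurable_fun setT F <->
  forall j, measurable_fun setT (fun t => (F t : 'cV[R]_M) j 0).
Proof.
split=> [mF j|mF].
  move=> _ B mB; rewrite setTI.
  rewrite [X in measurable X](_ : _ =
      F @^-1` ((fun v : 'cV[R]_M => v j 0) @^-1` B)) //.
  rewrite -[X in measurable X]setTI; apply: mF => //.
  apply: sub_sigma_algebra; apply: sub_sigma_algebra.
  case: M j F => [[]//|m] j F.
  rewrite -bigcup_mkord_ord; exists j; first exact: ltn_ord.
  by exists B => //; rewrite inord_val setTI.
pose G := g_sigma_preimage (fun (j : 'I_M) (v : 'cV[R]_M) => v j 0 : R).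
have GE : @measurable _ (mvec R M) = <<s G>> by [].
apply: (measurability _ GE); rewrite /G {G GE}.
move=> _ [B + <-]; rewrite /= setTI; move: B.
apply: smallest_sub.
  split=> [|B mB|B mB]; first by rewrite preimage_set0.
    by rewrite setTD preimage_setC; apply: measurableC.
  by rewrite preimage_bigcup; apply: bigcupT_measurable.
case: M F mF => [|m] F mF; first by rewrite big_ord0.
rewrite -bigcup_mkord_ord; apply: bigcup_sub => i _ _ [B mB <-].
rewrite setTI -[X in measurable X]setTI.
by have := mF (inord i) measurableT B mB; rewrite setTI.
Qed.

Section Expectation.
Context d (Omega : measurableType d) (R : realType) (P : probability Omega R).
Implicit Types (F G : Omega -> R).

Definition rv_int F : Prop := P.-integrable setT (EFin \o F).

Definition mean F : R := \int[P]_omega F omega.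

Lemma expectation_mean F : rv_int F -> 'E_P[F]%E = (mean F)%:E.
Proof.
move=> iF; rewrite unlock /mean /Rintegral fineK //.
exact: integrable_fin_num.
Qed.

Lemma rv_int_measurable F : rv_int F -> measurable_fun setT F.
Proof. by move=> /measurable_int/measurable_EFinP. Qed.

Lemma rv_int_dominated F G : measurable_fun setT F ->
  (forall omega, `|F omega| <= G omega) -> rv_int G -> rv_int F.
Proof.
move=> mF FG; apply: le_integrable => //; first exact/measurable_EFinP.
by move=> omega _; rewrite lee_fin (le_trans (FG omega)) // ler_norm.
Qed.

Lemma rv_int_cst a : rv_int (fun=> a).
Proof. exact: (finite_measure_integrable_cst P a). Qed.

Lemma rv_intD F G : rv_int F -> rv_int G -> rv_int (fun x => F x + G x).
Proof. by move=> iF iG; apply: (integrableD _ iF iG). Qed.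

Lemma rv_intZ a F : rv_int F -> rv_int (fun x => a * F x).
Proof. by move=> iF; apply: (integrableZl _ a iF). Qed.

Lemma rv_intB F G : rv_int F -> rv_int G -> rv_int (fun x => F x - G x).
Proof. by move=> iF iG; apply: (integrableB _ iF iG). Qed.

Lemma rv_int_sum (I : finType) (F : I -> Omega -> R) :
  (forall i, rv_int (F i)) -> rv_int (fun x => \sum_i F i x).
Proof.
move=> iF; apply: (eq_integrable measurableT (fun x => \sum_i (F i x)%:E)%E).
  by move=> x _ /=; rewrite sumEFin.
by apply: integrable_sum => // i _; apply: iF.
Qed.

Lemma mean_cst a : mean (fun=> a) = a.
Proof.
rewrite /mean Rintegral_cst //.
by rewrite [X in fine X](@probability_setT _ _ _ P) mulr1.
Qed.

Lemma meanD F G : rv_int F -> rv_int G ->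
  mean (fun x => F x + G x) = mean F + mean G.
Proof. by move=> iF iG; rewrite /mean RintegralD. Qed.

Lemma meanB F G : rv_int F -> rv_int G ->
  mean (fun x => F x - G x) = mean F - mean G.
Proof. by move=> iF iG; rewrite /mean RintegralB. Qed.

Lemma meanZ a F : rv_int F -> mean (fun x => a * F x) = a * mean F.
Proof. by move=> iF; rewrite /mean RintegralZl. Qed.

Lemma mean_le F G : rv_int F -> rv_int G ->
  (forall omega, F omega <= G omega) -> mean F <= mean G.
Proof. by move=> iF iG FG; apply: le_Rintegral. Qed.

Lemma mean_ge0 F : (forall omega, 0 <= F omega) -> 0 <= mean F.
Proof. by move=> F0; apply: Rintegral_ge0. Qed.

Lemma mean_sum (I : finType) (F : I -> Omega -> R) :
  (forall i, rv_int (F i)) ->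
  mean (fun x => \sum_i F i x) = \sum_i mean (F i).
Proof.
move=> iF.
suff H (s : seq I) : rv_int (fun x => \sum_(i <- s) F i x) /\
    mean (fun x => \sum_(i <- s) F i x) = \sum_(i <- s) mean (F i).
  by case: (H (index_enum I)).
elim: s => [|i s [iS IH]].
  under eq_fun do rewrite big_nil.
  by rewrite mean_cst big_nil; split => //; apply: rv_int_cst.
under eq_fun do rewrite big_cons.
by rewrite meanD // big_cons IH; split => //; apply: rv_intD.
Qed.

Section Vectors.
Variable M : nat.
Implicit Types (U V : Omega -> 'cV[R]_M).

Definition measurable_vec V : Prop :=
  forall j, measurable_fun setT (fun omega => V omega j 0).

Definition sq_int V : Prop :=
  measurable_vec V /\ rv_int (fun omega => sqn (V omega)).

Lemma measurable_dotv U V : measurable_vec U -> measurable_vec V ->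
  measurable_fun setT (fun omega => dotv (U omega) (V omega)).
Proof.
move=> mU mV; apply: measurable_sum => j.
by apply: measurable_funM; [exact: mU|exact: mV].
Qed.

Lemma measurable_vec_cst v : measurable_vec (fun=> v).
Proof. by move=> j; apply: measurable_cst. Qed.

Lemma measurable_vecD U V : measurable_vec U -> measurable_vec V ->
  measurable_vec (fun omega => U omega + V omega).
Proof.
move=> mU mV j; under eq_fun do rewrite mxE.
by apply: measurable_funD; [exact: mU|exact: mV].
Qed.

Lemma measurable_vecZ a V : measurable_vec V ->
  measurable_vec (fun omega => a *: V omega).
Proof.
move=> mV j; under eq_fun do rewrite mxE.
by apply: measurable_funM => //; exact: mV.
Qed.

Lemma sq_int_dominated V G : measurable_vec V -> rv_int G ->
  (forall omega, sqn (V omega) <= G omega) -> sq_int V.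
Proof.
move=> mV iG VG; split=> //; apply: rv_int_dominated iG.
  exact: measurable_dotv.
by move=> omega; rewrite ger0_norm ?sqn_ge0.
Qed.

Lemma sq_int_cst v : sq_int (fun=> v).
Proof. by split; [exact: measurable_vec_cst|exact: rv_int_cst]. Qed.

Lemma sq_intD U V : sq_int U -> sq_int V ->
  sq_int (fun omega => U omega + V omega).
Proof.
move=> [mU iU] [mV iV].
apply: (@sq_int_dominated _
  (fun omega => 2 * sqn (U omega) + 2 * sqn (V omega))).
- exact: measurable_vecD.
- by apply: rv_intD; apply: rv_intZ.
- by move=> omega; apply: sqnD_le.
Qed.

Lemma sq_intZ a V : sq_int V -> sq_int (fun omega => a *: V omega).
Proof.
move=> [mV iV]; split; first exact: measurable_vecZ.
by under eq_fun do rewrite sqnZ; apply: rv_intZ.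
Qed.

Lemma sq_intN V : sq_int V -> sq_int (fun omega => - V omega).
Proof. by move=> /(sq_intZ (-1)); under eq_fun do rewrite scaleN1r. Qed.

Lemma sq_intB U V : sq_int U -> sq_int V ->
  sq_int (fun omega => U omega - V omega).
Proof. by move=> sU sV; apply: sq_intD => //; apply: sq_intN. Qed.

Lemma sq_int_sum (I : finType) (F : I -> Omega -> 'cV[R]_M) :
  (forall i, sq_int (F i)) -> sq_int (fun omega => \sum_i F i omega).
Proof.
move=> sF.
suff H (s : seq I) : sq_int (fun omega => \sum_(i <- s) F i omega).
  exact: (H (index_enum I)).
elim: s => [|i s IH].
  by under eq_fun do rewrite big_nil; apply: sq_int_cst.
by under eq_fun do rewrite big_cons; apply: sq_intD.
Qed.

Lemma rv_int_dotv U V : sq_int U -> sq_int V ->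
  rv_int (fun omega => dotv (U omega) (V omega)).
Proof.
move=> [mU iU] [mV iV]; apply: (@rv_int_dominated _
    (fun omega => sqn (U omega) + sqn (V omega))).
- exact: measurable_dotv.
- move=> omega; have := dotv_young (U omega) (V omega) (@ltr01 R).
  have := dotv_young (- U omega) (V omega) (@ltr01 R).
  rewrite dotvNl sqnN invr1 !mul1r ler_norml.
  have := sqn_ge0 (U omega); have := sqn_ge0 (V omega); lra.
- exact: rv_intD.
Qed.

Lemma rv_int_coord U V j : sq_int U -> sq_int V ->
  rv_int (fun omega => U omega j 0 * V omega j 0).
Proof.
move=> [mU iU] [mV iV]; apply: (@rv_int_dominated _
    (fun omega => sqn (U omega) + sqn (V omega))).
- by apply: measurable_funM; [exact: mU|exact: mV].
- have le (v : 'cV[R]_M) : v j 0 ^+ 2 <= sqn v.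
    rewrite /sqn /dotv (bigD1 j) //= -expr2 lerDl sumr_ge0 // => i _.
    by rewrite -expr2 sqr_ge0.
  move=> omega; apply: le_trans (lerD (le (U omega)) (le (V omega))).
  move: (U omega j 0) (V omega j 0) => a b.
  by rewrite ler_norml; nra.
- exact: rv_intD.
Qed.

End Vectors.
End Expectation.

(** * Noise that is centered given the past *)

Section CenteredGivenPast.
Import HBNNSimple.
Context d (Omega : measurableType d) (R : realType) (P : probability Omega R).
Variables (G : set (set Omega)) (S : Omega -> R).
Hypotheses (mG : G `<=` measurable) (hS : is_cond_exp P <<s G>> S (fun=> 0)).

Lemma generated_measurable E : <<s G>> E -> measurable E.
Proof.
move=> GE; apply: (smallest_sub _ mG GE).
exact: sigma_algebra_measurable.
Qed.

Let iS : rv_int P S. Proof. by case: hS. Qed.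

Let restrict_indic E a (omega : Omega) :
  a * \1_E omega * S omega = a * (S \_ E) omega.
Proof.
rewrite -mulrA indicE patchE.
by case: ifP => _; rewrite ?mul1r ?mul0r.
Qed.

Lemma centered_indic E a : <<s G>> E ->
  rv_int P (fun omega => a * \1_E omega * S omega) /\
  mean P (fun omega => a * \1_E omega * S omega) = 0.
Proof.
move=> GE; have mE := generated_measurable GE.
have iSE : rv_int P (S \_ E).
  rewrite /rv_int -restrict_EFin; apply/(integrable_mkcond _ mE).
  exact: (integrableS measurableT).
under eq_fun do rewrite restrict_indic.
split; first exact: rv_intZ.
rewrite meanZ // /mean -Rintegral_mkcond /Rintegral.
case: hS => _ _ _ ->//; by rewrite integral0 mulr0.
Qed.

(** Nonnegative simple functions of the past approximate [Z] from below, and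
    [`|Z * S|] dominates the products. *)
Lemma centered_orthogonal_ge0 (Z : Omega -> R) :
  (forall B, measurable B -> <<s G>> (Z @^-1` B)) ->
  (forall omega, 0 <= Z omega) ->
  rv_int P (fun omega => Z omega * S omega) ->
  mean P (fun omega => Z omega * S omega) = 0.
Proof.
move=> GZ Z0 iZS.
pose T : measurableType _ := g_sigma_algebraType G.
pose Z' : T -> \bar R := fun t => (Z t)%:E.
have mZ' : measurable_fun setT Z'.
  apply/measurable_EFinP => _ B mB; rewrite setTI; exact: GZ.
have Z'0 (t : T) : setT t -> (0 <= Z' t)%E by rewrite lee_fin.
pose h n : Omega -> R := nnsfun_approx measurableT mZ' n.
have h0 n omega : 0 <= h n omega by exact: fun_ge0.
have hc omega : EFin \o (fun n => h n omega) @ \oo --> Z' omega.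
  exact: cvg_nnsfun_approx.
have hZ n omega : h n omega <= Z omega.
  rewrite /h nnsfun_approxE -lee_fin.
  exact: (@le_approx _ T R setT Z' n omega Z'0).
have hsum n : exists s : seq R, forall omega, h n omega * S omega =
    \sum_(y <- s) (y * \1_(h n @^-1` [set y]) omega * S omega).
  eexists => omega; rewrite -mulr_suml; congr (_ * _).
  by rewrite [LHS]fimfunE fsbig_finite //; exact: fimfunP.
have hE n y : <<s G>> (h n @^-1` [set y]).
  exact: (@measurable_funPTI _ _ T R (nnsfun_approx measurableT mZ' n)).
have hi n : rv_int P (fun omega => h n omega * S omega) /\
    mean P (fun omega => h n omega * S omega) = 0.
  have [s hs] := hsum n; under eq_fun do rewrite hs.
  elim: s {hs} => [|y s [IHi IHm]].
    by under eq_fun do rewrite big_nil; split;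
      [exact: rv_int_cst|exact: mean_cst].
  under eq_fun do rewrite big_cons.
  have [yi ym] := centered_indic y (hE n y).
  by rewrite meanD // ym IHm addr0; split => //; apply: rv_intD.
have hS_cvg : {ae P, forall omega, setT omega ->
    (h n omega * S omega)%:E @[n --> \oo] --> (Z omega * S omega)%:E}.
  apply/aeW => omega _; apply: cvg_EFin; first exact: nearW.
  by apply: cvgM; [have /fine_cvgP[_] := hc omega|exact: cvg_cst].
have hS_dom : {ae P, forall omega n, setT omega ->
    (`|(h n omega * S omega)%:E| <= `|(Z omega * S omega)%:E|)%E}.
  apply/aeW => omega n _; rewrite lee_fin !normrM ler_wpM2r //.
  by rewrite !ger0_norm.
have [_ _] := dominated_convergence measurableT
  (fun n => measurable_int _ (proj1 (hi n))) (measurable_int _ iZS)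
  hS_cvg (integrable_abse iZS) hS_dom.
rewrite (_ : [sequence _]_n = cst 0%E).
  by move=> /(cvg_lim (@ereal_hausdorff R)); rewrite lim_cst // /mean /Rintegral => <-.
apply/funext => n; rewrite /= -[RHS](congr1 EFin (proj2 (hi n))).
by rewrite /mean /Rintegral fineK //; apply: integrable_fin_num (proj1 (hi n)).
Qed.

(** The positive and negative parts of [Z] reduce this to the nonnegative
    case. *)
Lemma centered_orthogonal (Z : Omega -> R) :
  (forall B, measurable B -> <<s G>> (Z @^-1` B)) ->
  rv_int P (fun omega => Z omega * S omega) ->
  mean P (fun omega => Z omega * S omega) = 0.
Proof.
move=> GZ iZS.
have mS := rv_int_measurable iS.
have part (phi : R -> R) : measurable_fun setT phi ->
    (forall z, 0 <= phi z <= `|z|) ->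
    rv_int P (fun omega => phi (Z omega) * S omega) /\
    mean P (fun omega => phi (Z omega) * S omega) = 0.
  move=> mphi phi_le.
  have Gphi B : measurable B -> <<s G>> ((phi \o Z) @^-1` B).
    move=> mB; rewrite comp_preimage; apply: GZ.
    by rewrite -[X in measurable X]setTI; apply: mphi.
  have iphi : rv_int P (fun omega => phi (Z omega) * S omega).
    apply: (rv_int_dominated (G := fun omega => `|Z omega * S omega|)).
    - apply: measurable_funM => //.
      move=> _ B mB; rewrite setTI; exact: generated_measurable (Gphi B mB).
    - move=> omega; rewrite !normrM ler_wpM2r //.
      by have /andP[p0 ple] := phi_le (Z omega); rewrite ger0_norm.
    - exact: (integrable_norm iZS).
  split=> //; apply: (centered_orthogonal_ge0 Gphi) => // omega.
  by case/andP: (phi_le (Z omega)).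
have mid : measurable_fun setT (@id R) by [].
have m0 : measurable_fun setT (cst 0 : R -> R) by [].
have [ip mp] : rv_int P (fun omega => Num.max (Z omega) 0 * S omega) /\
    mean P (fun omega => Num.max (Z omega) 0 * S omega) = 0.
  apply: (part (fun z => Num.max z 0)); first exact: measurable_maxr.
  by move=> z; rewrite le_max lexx orbT ge_max ler_norm normr_ge0.
have [iN mN] : rv_int P (fun omega => Num.max (- Z omega) 0 * S omega) /\
    mean P (fun omega => Num.max (- Z omega) 0 * S omega) = 0.
  apply: (part (fun z => Num.max (- z) 0)).
    by apply: measurable_maxr => //; exact: measurableT_comp.
  by move=> z; rewrite le_max lexx orbT ge_max -normrN ler_norm normr_ge0.
have E := meanB ip iN; rewrite mp mN subr0 in E; rewrite -E.
congr (mean P _); apply/funext => omega.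
rewrite -mulrBl; congr (_ * _); rewrite !maxEle.
case: (leP (Z omega) 0); case: (leP (- Z omega) 0) => *; lra.
Qed.

End CenteredGivenPast.

(** * Moments of the diffusion iterates *)

Section Diffusion.
Context (d dY : measure_display) (Omega : measurableType d) (R : realType) (P : probability Omega R).
Context (N M : nat) (nbh : 'I_N -> {set 'I_N}) (A : 'M[R]_N) (p : 'cV[R]_N).
Hypotheses (hA : left_stochastic nbh A) (hp : perron_vector A p).
Variables (J : 'I_N -> 'cV[R]_M -> R) (eta e f : 'I_N -> R).
Hypotheses (heta : forall k, 0 < eta k)
  (hsc : forall k, strongly_convex (J k) (eta k))
  (hal : forall k, affine_lipschitz (J k) (e k) (f k)).
Arguments hsc : clear implicits.
Arguments hal : clear implicits.
Variables (wstar : 'cV[R]_M) (gstar : 'I_N -> 'cV[R]_M)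
  (g : 'I_N -> 'cV[R]_M -> 'cV[R]_M).
Hypotheses (hgstar : forall k, subdifferential (J k) wstar (gstar k))
  (hg : forall k w, subdifferential (J k) w (g k w)).
Arguments hgstar : clear implicits.
Arguments hg : clear implicits.
Context (Y : 'I_N -> measurableType dY) (y : forall k, nat -> {RV P >-> Y k}).
Variable ghat : forall k, 'cV[R]_M -> Y k -> 'cV[R]_M.
Arguments ghat : clear implicits.
Hypothesis hghat : forall k, measurable_fun setT
  (fun u : mvec R M * Y k => ghat k u.1 u.2 : mvec R M).
Variables (beta sigma : 'I_N -> R) (w0 : 'I_N -> Omega -> 'cV[R]_M).
Hypothesis hw0 : forall k, measurable_fun setT (w0 k : Omega -> mvec R M).
Hypothesis hw02 : forall k,
  ('E_P[fun omega => (enorm (w0 k omega - wstar) ^+ 2)%R] < +oo)%E.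
Variable mu : 'I_N -> R.
Hypothesis mu_gt0 : forall k, 0 < mu k.
Let w := diffusion nbh A mu ghat y w0.
Hypothesis hnoise :
  noise_moments P (gradient_noise ghat g y) w wstar beta sigma.
Arguments hnoise : clear implicits.

Let A0 l k : 0 <= A l k. Proof. by case: hA. Qed.
Let A1 k : \sum_l A l k = 1. Proof. by case: hA. Qed.
Let Ap : A *m p = p. Proof. by case: hp. Qed.
Let p_gt0 k : 0 < p k 0. Proof. by case: hp. Qed.
Let p_ge0 k : 0 <= p k 0. Proof. exact: ltW (p_gt0 k). Qed.
Let p1 : \sum_k p k 0 = 1. Proof. by case: hp. Qed.

Definition approx_grad n k omega : 'cV[R]_M :=
  ghat k (w n k omega) (y k n.+1 omega).

Definition iterate_error n k omega : 'cV[R]_M := w n k omega - wstar.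

Definition msd n k : R := mean P (fun omega => sqn (iterate_error n k omega)).

Lemma diffusion_step n omega :
  (fun k => w n.+1 k omega) =
  mix A (fun l => w n l omega - mu l *: approx_grad n l omega).
Proof.
apply/funext => k; rewrite /w /= big_mkcond /mix; apply: eq_bigr => l _.
by case: ifPn => // lk; case: hA => _ _ _ -> //; rewrite scale0r.
Qed.

Lemma error_step n omega :
  (fun k => iterate_error n.+1 k omega) =
  mix A (fun l => iterate_error n l omega - mu l *: approx_grad n l omega).
Proof.
apply/funext => k; rewrite /iterate_error.
rewrite (congr1 (fun F => F k) (diffusion_step n omega)) /mix.
under [RHS]eq_bigr do rewrite addrAC scalerBr.
by rewrite sumrB -scaler_suml A1 scale1r.
Qed.

Let noise n k omega : 'cV[R]_M := approx_grad n k omega - g k (w n k omega).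

Let noise_sq_int n k : sq_int P (noise n k).
Proof.
have [s1 [V [s2 _ _ _] _]] := hnoise k n; split.
  move=> j; exact: (rv_int_measurable (let: And4 H _ _ _ := s1 j in H)).
move: s2; congr (P.-integrable _ (EFin \o _)); apply/funext => omega.
by rewrite enorm_sqr.
Qed.

Let measurable_approx_grad n k : measurable_vec (w n k) ->
  measurable_vec (approx_grad n k).
Proof.
move=> /measurable_mvecP mw; apply/measurable_mvecP.
apply: (measurableT_comp (@hghat k)
  (g := fun omega => ((w n k omega : mvec R M), y k n.+1 omega))).
exact: measurable_fun_pair.
Qed.

Let moments_step n k : sq_int P (iterate_error n k) ->
  sq_int P (fun omega => g k (w n k omega)) /\ sq_int P (approx_grad n k).
Proof.
move=> sw; have [mw iw] := sw; have [ms is_] := noise_sq_int n k.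
have mwk : measurable_vec (w n k).
  move=> j; rewrite (_ : (fun _ => _) =
      (fun omega => (iterate_error n k omega + wstar) j 0)).
    exact: (measurable_vecD mw (measurable_vec_cst wstar)).
  by apply/funext => omega; rewrite subrK.
have sg : sq_int P (fun omega => g k (w n k omega)).
  apply: (@sq_int_dominated _ _ _ _ _ _ (fun omega =>
    2 * (e k ^+ 2 * sqn (iterate_error n k omega) + f k ^+ 2)
    + 2 * sqn (gstar k))).
  (* The selection [g k] itself need not be a measurable function; along the
     iterates it is the difference of two measurable vectors. *)
  - move=> j; rewrite (_ : (fun _ => _) =
      (fun omega => (approx_grad n k omega + (-1) *: noise n k omega) j 0)).
      apply: measurable_vecD; first exact: measurable_approx_grad.
      exact: measurable_vecZ.
    by apply/funext => omega; rewrite scaleN1r opprB addrC subrK.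
  - apply: rv_intD; last exact: rv_int_cst.
    by apply: rv_intZ; apply: rv_intD;
      [exact: rv_intZ|exact: rv_int_cst].
  - move=> omega; have := sqnD_le (g k (w n k omega) - gstar k) (gstar k).
    rewrite subrK.
    have := sqn_subgradient_le (hal k) (hg k (w n k omega)) (hgstar k).
    rewrite /iterate_error; lra.
split=> //; rewrite (_ : approx_grad n k =
    (fun omega => noise n k omega + g k (w n k omega))).
  exact: sq_intD.
by apply/funext => omega; rewrite subrK.
Qed.

Lemma iterate_error_sq_int n k : sq_int P (iterate_error n k).
Proof.
elim: n k => [|n IH] k.
  have m0 : measurable_vec (iterate_error 0%N k).
    rewrite /iterate_error.
    under eq_fun do rewrite -[- wstar]scaleN1r.
    apply: measurable_vecD; first exact/measurable_mvecP.
    exact: measurable_vec_cst.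
  split=> //; apply/integrableP; split.
    by apply/measurable_EFinP; exact: measurable_dotv.
  apply: le_lt_trans (hw02 k); rewrite unlock.
  rewrite le_eqVlt; apply/orP; left; apply/eqP.
  apply: eq_integral => omega _ /=.
  by rewrite ger0_norm ?sqn_ge0 // enorm_sqr.
have -> : iterate_error n.+1 k = (fun omega => \sum_l A l k *:
    (iterate_error n l omega - mu l *: approx_grad n l omega)).
  by apply/funext => omega;
    rewrite (congr1 (fun F => F k) (error_step n omega)).
apply: sq_int_sum => l; apply: sq_intZ; apply: sq_intB; first exact: IH.
by apply: sq_intZ; case: (moments_step (IH l)).
Qed.

Lemma approx_grad_sq_int n k : sq_int P (approx_grad n k).
Proof. by case: (moments_step (iterate_error_sq_int n k)). Qed.

Lemma true_grad_sq_int n k : sq_int P (fun omega => g k (w n k omega)).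
Proof. by case: (moments_step (iterate_error_sq_int n k)). Qed.

Lemma iterate_sq_int n k : sq_int P (w n k).
Proof.
rewrite (_ : w n k = (fun omega => iterate_error n k omega + wstar)).
  by apply: sq_intD; [exact: iterate_error_sq_int|exact: sq_int_cst].
by apply/funext => omega; rewrite subrK.
Qed.

Lemma msd_ge0 n k : 0 <= msd n k.
Proof. by apply: mean_ge0 => omega; apply: sqn_ge0. Qed.

Let past_generators n : set (set Omega) :=
  [set E | exists j k (B : set (mvec R M)),
     [/\ (j <= n)%N, measurable B & E = w j k @^-1` B]].

Let past_generators_measurable n : past_generators n `<=` measurable.
Proof.
move=> _ [j [k [B [_ mB ->]]]]; rewrite -[X in measurable X]setTI.
have [mw _] := iterate_sq_int j k.
by move/measurable_mvecP: mw; apply.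
Qed.

Let past_measurable_coord n k j B : measurable B ->
  <<s past_generators n>> ((fun omega => iterate_error n k omega j 0) @^-1` B).
Proof.
move=> mB; apply: sub_sigma_algebra; exists n, k.
exists ((fun v : mvec R M => (v : 'cV[R]_M) j 0 - wstar j 0) @^-1` B); split=> //.
  rewrite -[X in measurable X]setTI.
  have mv : measurable_fun setT (fun v : mvec R M => (v : 'cV[R]_M) j 0).
    by move: j; apply/measurable_mvecP.
  by apply: (measurable_funD mv (measurable_cst (- wstar j 0))).
by apply/funext => omega; rewrite /preimage /= !mxE.
Qed.

Lemma mean_dotv_noise n k :
  mean P (fun omega => dotv (iterate_error n k omega) (noise n k omega)) = 0.
Proof.
have sw := iterate_error_sq_int n k; have ss := noise_sq_int n k.
rewrite /dotv mean_sum; last by move=> j; exact: rv_int_coord.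
rewrite big1 // => j _; have [s1 _] := hnoise k n.
apply: (centered_orthogonal (@past_generators_measurable n) (s1 j)).
  exact: past_measurable_coord.
exact: rv_int_coord.
Qed.

Lemma mean_noise_le n k :
  mean P (fun omega => sqn (noise n k omega)) <=
    beta k ^+ 2 * msd n k + sigma k ^+ 2.
Proof.
have [_ [V [_ iV _ hV] leV]] := hnoise k n.
have [_ iw] := iterate_error_sq_int n k.
have iU : rv_int P (fun omega =>
    beta k ^+ 2 * sqn (iterate_error n k omega) + sigma k ^+ 2).
  by apply: rv_intD; [exact: rv_intZ|exact: rv_int_cst].
have -> : beta k ^+ 2 * msd n k + sigma k ^+ 2 = mean P (fun omega =>
    beta k ^+ 2 * sqn (iterate_error n k omega) + sigma k ^+ 2).
  by rewrite meanD ?mean_cst ?meanZ //; [exact: rv_intZ|exact: rv_int_cst].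
have T : past w n setT.
  by rewrite -setC0; apply: sigma_algebraC; exact: sigma_algebra0.
have {hV} := hV setT T => hV.
rewrite -lee_fin -!expectation_mean //; last by case: (noise_sq_int n k).
rewrite unlock; apply: le_trans (_ : \int[P]_omega (V omega)%:E <= _)%E.
  rewrite -hV; rewrite le_eqVlt; apply/orP; left; apply/eqP.
  by apply: eq_integral => omega _; rewrite enorm_sqr.
have U0 omega :
    0 <= beta k ^+ 2 * sqn (iterate_error n k omega) + sigma k ^+ 2.
  by rewrite addr_ge0 ?sqr_ge0 // mulr_ge0 ?sqr_ge0 ?sqn_ge0.
have iVp := integrable_funepos measurableT iV.
apply: le_trans (_ : \int[P]_omega ((EFin \o V)^\+ omega) <= _)%E.
  by apply: le_integral => // omega _; rewrite funeposE le_max lexx.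
apply: ae_ge0_le_integral => //.
- exact: measurable_int iVp.
- by move=> omega _; rewrite lee_fin.
- exact: measurable_int iU.
- apply: filterS leV => omega /= le _; rewrite funeposE ge_max !lee_fin.
  rewrite U0 andbT.
  by move: le; rewrite enorm_sqr sqnC.
Qed.

Definition growth k : R := 2 * beta k ^+ 2 + 4 * e k ^+ 2.

Definition offset k : R :=
  2 * sigma k ^+ 2 + 4 * f k ^+ 2 + 4 * sqn (gstar k).

(** The subgradients selected along the iterates need not be measurable with
    respect to the past, so the noise may be correlated with them: the squared
    triangle inequality, with its factor 2, stands in for orthogonality. *)
Lemma mean_approx_grad_le n k :
  mean P (fun omega => sqn (approx_grad n k omega)) <=
    growth k * msd n k + offset k.
Proof.
have [_ iw] := iterate_error_sq_int n k.
have [_ iS] := noise_sq_int n k; have [_ ig] := approx_grad_sq_int n k.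
have iE : rv_int P (fun omega => 4 * e k ^+ 2 * sqn (iterate_error n k omega)).
  exact: rv_intZ.
have i2S : rv_int P (fun omega => 2 * sqn (noise n k omega)) by exact: rv_intZ.
have iC := rv_int_cst P (4 * f k ^+ 2 + 4 * sqn (gstar k)).
have H : mean P (fun omega => sqn (approx_grad n k omega)) <=
    mean P (fun omega => 2 * sqn (noise n k omega)
      + 4 * e k ^+ 2 * sqn (iterate_error n k omega)
      + (4 * f k ^+ 2 + 4 * sqn (gstar k))).
  apply: mean_le => //; first by apply: rv_intD => //; exact: rv_intD.
  move=> omega; have := sqnD_le (noise n k omega) (g k (w n k omega)).
  rewrite /noise subrK.
  have := sqnD_le (g k (w n k omega) - gstar k) (gstar k); rewrite subrK.
  have := sqn_subgradient_le (hal k) (hg k (w n k omega)) (hgstar k).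
  rewrite -/(iterate_error n k omega); lra.
apply: le_trans H _; rewrite meanD //; last exact: rv_intD.
rewrite meanD // !meanZ // mean_cst -/(msd n k) /growth /offset.
have := mean_noise_le n k; lra.
Qed.

Definition gap n k omega : R := J k (w n k omega) - J k wstar.

Lemma gap_rv_int n k : rv_int P (gap n k).
Proof.
have [mw _] := iterate_sq_int n k; have [_ iw] := iterate_error_sq_int n k.
have [_ ig] := true_grad_sq_int n k.
apply: (@rv_int_dominated _ _ _ _ _ (fun omega =>
  sqn (g k (w n k omega)) + sqn (iterate_error n k omega) + sqn (gstar k))).
- apply: measurable_funB; last exact: measurable_cst.
  exact: (measurable_risk (hal k) (hg k) mw).
- move=> omega; have := gap_upper (hsc k) wstar (hg k (w n k omega)).
  have := gap_lower (hsc k) (w n k omega) (hgstar k).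
  rewrite -/(iterate_error n k omega) -/(gap n k omega).
  have := dotv_young (g k (w n k omega)) (iterate_error n k omega) (@ltr01 R).
  have := dotv_young (- gstar k) (iterate_error n k omega) (@ltr01 R).
  rewrite dotvNl sqnN invr1.
  have := mulr_ge0 (ltW (heta k)) (sqn_ge0 (iterate_error n k omega)).
  have := sqn_ge0 (iterate_error n k omega).
  have := sqn_ge0 (gstar k); have := sqn_ge0 (g k (w n k omega)).
  rewrite ler_norml; lra.
- by apply: rv_intD; [exact: rv_intD|exact: rv_int_cst].
Qed.

Definition mean_gap n k : R := mean P (gap n k).

(** The noise drops out of the inner product, as the error only depends on the
    past; what remains is the strong convexity inequality. *)
Lemma mean_descent n k :
  mean_gap n k + eta k / 2 * msd n k <=
  mean P (fun omega => dotv (iterate_error n k omega) (approx_grad n k omega)).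
Proof.
have sw := iterate_error_sq_int n k; have sg := true_grad_sq_int n k.
have ss := noise_sq_int n k; have [_ iw] := sw.
have -> : mean P (fun omega =>
      dotv (iterate_error n k omega) (approx_grad n k omega)) =
    mean P (fun omega =>
      dotv (iterate_error n k omega) (g k (w n k omega))).
  rewrite -[RHS]addr0 -(mean_dotv_noise n k) -meanD; try exact: rv_int_dotv.
  congr (mean P _); apply/funext => omega; rewrite -dotvDr /noise.
  by rewrite addrC subrK.
rewrite /mean_gap /msd -meanZ // -meanD //; last 2 first.
- exact: gap_rv_int.
- exact: rv_intZ.
apply: mean_le.
- by apply: rv_intD; [exact: gap_rv_int|exact: rv_intZ].
- exact: rv_int_dotv.
- move=> omega; have := gap_upper (hsc k) wstar (hg k (w n k omega)).
  rewrite -/(iterate_error n k omega) -/(gap n k omega) dotvC; lra.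
Qed.

(** The gap may be negative, as [wstar] does not minimize the individual risks.
    Young's inequality with [t = (eta k)^-1] removes the mean-square deviation
    from this lower bound; letting [t] tend to 0 shows that the gap is
    nonnegative where the mean-square deviation vanishes. *)
Lemma mean_gap_ge n k (t : R) : 0 < t ->
  (eta k - t^-1) * msd n k - t * sqn (gstar k) <= 2 * mean_gap n k.
Proof.
move=> t0; have [_ iw] := iterate_error_sq_int n k.
have iG := gap_rv_int n k.
have iU : rv_int P (fun omega =>
    (eta k - t^-1) * sqn (iterate_error n k omega)) by exact: rv_intZ.
have iC := rv_int_cst P (t * sqn (gstar k)).
rewrite /mean_gap /msd -!meanZ // -[t * sqn _](mean_cst P) -meanB //.
apply: mean_le; [exact: rv_intB|exact: rv_intZ|move=> omega].
have := gap_lower (hsc k) (w n k omega) (hgstar k).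
rewrite -/(iterate_error n k omega) -/(gap n k omega).
have := dotv_young (- gstar k) (iterate_error n k omega) t0.
rewrite dotvNl sqnN; lra.
Qed.

Lemma msd_eta_le n k : eta k ^+ 2 * msd n k <= e k ^+ 2 * msd n k.
Proof.
have [_ iw] := iterate_error_sq_int n k.
rewrite /msd -!meanZ //; apply: mean_le => [||omega]; try exact: rv_intZ.
exact: (strong_convexity_le_lipschitz (heta k) (hsc k) (hal k) (hg k)).
Qed.

Definition total_msd n : R := \sum_k p k 0 * msd n k.

Lemma energy_rv_int (F : 'I_N -> Omega -> 'cV[R]_M) :
  (forall k, sq_int P (F k)) ->
  rv_int P (fun omega => energy p (fun k => F k omega)) /\
  mean P (fun omega => energy p (fun k => F k omega)) =
    \sum_k p k 0 * mean P (fun omega => sqn (F k omega)).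
Proof.
move=> sF.
have iF k : rv_int P (fun omega => p k 0 * sqn (F k omega)).
  by apply: rv_intZ; case: (sF k).
split; first exact: rv_int_sum.
rewrite /energy mean_sum //; apply: eq_bigr => k _.
by rewrite meanZ //; case: (sF k).
Qed.

(** By Jensen's inequality the combination step does not increase the weighted
    error, so only the gradient step counts: this is the classical subgradient
    recursion, with every risk evaluated at its own agent's iterate. *)
Lemma total_msd_step n :
  total_msd n.+1 <= \sum_k p k 0 *
    ((1 - mu k * eta k + mu k ^+ 2 * growth k) * msd n k
      - 2 * mu k * mean_gap n k + mu k ^+ 2 * offset k).
Proof.
have sw k := iterate_error_sq_int n k; have sa k := approx_grad_sq_int n k.
have sb k : sq_int P (fun omega =>
    iterate_error n k omega - mu k *: approx_grad n k omega).
  by apply: sq_intB => //; exact: sq_intZ.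
have [iE mE] := energy_rv_int sb.
have [iS mS] := energy_rv_int (iterate_error_sq_int n.+1).
rewrite /total_msd /msd -mS; apply: le_trans (_ : _ <= mean P (fun omega =>
    energy p (fun k => iterate_error n k omega
      - mu k *: approx_grad n k omega))) _.
  by apply: mean_le => // omega; rewrite error_step; exact: energy_mix.
rewrite mE; apply: ler_sum => k _; apply: ler_wpM2l => //.
have [_ iw] := sw k; have [_ ia] := sa k.
have id : rv_int P (fun omega =>
    dotv (iterate_error n k omega) (approx_grad n k omega)).
  exact: rv_int_dotv.
have -> : (fun omega => sqn (iterate_error n k omega
      - mu k *: approx_grad n k omega)) =
    (fun omega => sqn (iterate_error n k omega)
      - 2 * mu k * dotv (iterate_error n k omega) (approx_grad n k omega)
      + mu k ^+ 2 * sqn (approx_grad n k omega)).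
  by apply/funext => omega; rewrite sqnD sqnN sqnZ dotvNr dotvZr; ring.
have i1 : rv_int P (fun omega => 2 * mu k
    * dotv (iterate_error n k omega) (approx_grad n k omega)).
  exact: rv_intZ.
rewrite meanD; [|exact: rv_intB|exact: rv_intZ].
rewrite meanB // !meanZ // -/(msd n k).
have /(ler_wpM2l (sqr_ge0 (mu k))) := mean_approx_grad_le n k.
have /(ler_wpM2l (ltW (mu_gt0 k))) := mean_descent n k.
lra.
Qed.

(** * Network disagreement *)

Definition disagreement n : R :=
  mean P (fun omega => energy p (deviation p (fun k => w n k omega))).

(** What the gradient steps taken since time [n] have subtracted from the
    iterates that pure mixing would have produced at time [n + j]. *)
Let drift n j k omega : 'cV[R]_M :=
  mix (A ^+ j) (fun l => w n l omega) k - w (n + j)%N k omega.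

Let drift_step n j omega : (fun k => drift n j.+1 k omega) =
  mix A (fun k => drift n j k omega + mu k *: approx_grad (n + j) k omega).
Proof.
apply/funext => k; rewrite /drift exprSr -mulmxE mixM addnS.
rewrite (congr1 (fun F => F k) (diffusion_step (n + j) omega)).
set X := mix (A ^+ j) _; set Z := fun l => w (n + j)%N l omega - _.
rewrite -(congr1 (fun F => F k) (mixB A X Z)) /Z.
by congr (mix A _ k); apply/funext => l; rewrite opprB addrA addrAC.
Qed.

Let drift_sq_int n j k : sq_int P (drift n j k).
Proof.
apply: sq_intB; last exact: iterate_sq_int.
by apply: sq_int_sum => l; apply: sq_intZ; exact: iterate_sq_int.
Qed.

(** An upper bound for the mean energy of the gradient steps of round [n.+1]. *)
Definition step_energy n : R :=
  \sum_k p k 0 * (mu k ^+ 2 * (growth k * msd n k + offset k)).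

(** Each round at most doubles the mean energy of the drift and adds [2 * c];
    [(2 ^+ j.+1 - 2) * c] solves this recursion. *)
Let drift_energy_le n (c : R) j :
  (forall i, (n <= i)%N -> step_energy i <= c) -> 0 <= c ->
  mean P (fun omega => energy p (fun k => drift n j k omega)) <=
    (2 ^+ j.+1 - 2) * c.
Proof.
move=> cP c0; elim: j => [|j IH].
  rewrite (_ : (fun omega => _) = fun=> 0) ?mean_cst ?expr1 ?subrr ?mul0r //.
  apply/funext => omega; rewrite /energy big1 // => k _.
  by rewrite /drift expr0 mix1 addn0 subrr sqn0 mulr0.
have sG k : sq_int P (fun omega => mu k *: approx_grad (n + j) k omega).
  by apply: sq_intZ; exact: approx_grad_sq_int.
have [iD _] := energy_rv_int (drift_sq_int n j).
have [iD' _] := energy_rv_int (drift_sq_int n j.+1).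
have [iG mG] := energy_rv_int sG.
apply: le_trans (_ : _ <= mean P (fun omega =>
    2 * energy p (fun k => drift n j k omega)
    + 2 * energy p (fun k => mu k *: approx_grad (n + j) k omega))) _.
  apply: mean_le => // [|omega]; first by apply: rv_intD; apply: rv_intZ.
  rewrite drift_step; apply: le_trans (energy_mix _ p_ge0 A0 A1 Ap) _.
  have := energyD_le (fun k => drift n j k omega)
    (fun k => mu k *: approx_grad (n + j) k omega) p_ge0 (@ltr01 R).
  by rewrite invr1.
rewrite meanD; [|exact: rv_intZ..]; rewrite !meanZ // mG.
have : \sum_k p k 0 * mean P (fun omega =>
    sqn (mu k *: approx_grad (n + j) k omega)) <= c.
  apply: le_trans (cP (n + j)%N (leq_addr _ _)).
  apply: ler_sum => k _; apply: ler_wpM2l => //.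
  under eq_fun do rewrite sqnZ.
  rewrite meanZ; last by case: (approx_grad_sq_int (n + j) k).
  by rewrite ler_wpM2l ?sqr_ge0 // mean_approx_grad_le.
by move: IH; rewrite (exprS 2 j.+1); lra.
Qed.

Lemma deviation_sq_int n k :
  sq_int P (fun omega => deviation p (fun l => w n l omega) k).
Proof.
apply: sq_intB; last exact: iterate_sq_int.
by apply: sq_int_sum => l; apply: sq_intZ; exact: iterate_sq_int.
Qed.

(** Over [m + 1] rounds the mixing alone contracts the disagreement by
    [(1 - eps) ^+ 2]; one factor pays for splitting off the drift. *)
Lemma disagreement_step m (eps c : R) n : 0 < eps <= 1 ->
  (forall l k, eps * p l 0 <= (A ^+ m.+1) l k) ->
  (forall i, (n <= i)%N -> step_energy i <= c) -> 0 <= c ->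
  disagreement (n + m.+1)%N <=
    (1 - eps) * disagreement n + 2 / eps * (2 ^+ m.+2 * c).
Proof.
move=> /andP[e0 e1] epsP cP c0.
have [iV _] := energy_rv_int (deviation_sq_int n).
have [iV' _] := energy_rv_int (deviation_sq_int (n + m.+1)%N).
have [iD _] := energy_rv_int (drift_sq_int n m.+1).
apply: le_trans (_ : _ <= mean P (fun omega =>
    (1 - eps) * energy p (deviation p (fun k => w n k omega))
    + 2 / eps * energy p (fun k => drift n m.+1 k omega))) _.
  apply: mean_le => // [|omega]; first by apply: rv_intD; apply: rv_intZ.
  pose W k := w n k omega; pose D k := drift n m.+1 k omega.
  have -> : (fun k => w (n + m.+1)%N k omega) =
      (fun k => mix (A ^+ m.+1) W k - D k).
    by apply/funext => k; rewrite /D /drift opprB addrC subrK.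
  rewrite deviationB; apply: le_trans (@energyD_le _ _ _ eps p
    (deviation p (mix (A ^+ m.+1) W)) (fun k => - deviation p D k) p_ge0 e0) _.
  have A1' k : \sum_l (A ^+ m.+1) l k = 1 by exact: exp_mx_col_sum.
  have := doeblin_contraction W p_ge0 p1 epsP A1' (exp_mx_perron _ Ap).
  have V0 := energy_ge0 (deviation p W) p_ge0.
  have D0 := energy_ge0 D p_ge0.
  have -> : energy p (fun k => - deviation p D k) = energy p (deviation p D).
    by rewrite /energy; under eq_bigr do rewrite sqnN.
  have DD := energy_deviation D p_ge0 p1.
  have ie : 1 <= eps^-1 by rewrite invf_ge1.
  move=> VV; apply: lerD.
    have e1' : 0 <= 1 + eps by lra.
    apply: le_trans (ler_wpM2l e1' VV) _.
    rewrite mulrA ler_wpM2r //.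
    have : 0 <= eps ^+ 2 * (1 - eps) by rewrite mulr_ge0 ?sqr_ge0 //; lra.
    lra.
  have e1' : 0 <= 1 + eps^-1 by lra.
  by apply: le_trans (ler_wpM2l e1' DD) _; rewrite ler_wpM2r //; lra.
rewrite meanD; [|exact: rv_intZ..]; rewrite !meanZ // lerD2l.
rewrite ler_wpM2l ?divr_ge0 ?(ltW e0) //.
by apply: le_trans (drift_energy_le m.+1 cP c0) _; rewrite ler_wpM2r //; lra.
Qed.

Lemma mean_deviation_le n k : 
  p k 0 * mean P (fun omega => sqn (deviation p (fun l => w n l omega) k)) <=
    disagreement n.
Proof.
have [iV _] := energy_rv_int (deviation_sq_int n).
have [_ iK] := deviation_sq_int n k.
rewrite -meanZ //; apply: mean_le => // [|omega]; first exact: rv_intZ.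
exact: deviation_le.
Qed.

End Diffusion.
(** * From the second-moment recursion to the bounds *)

Section Recursion.
Variables (R : realType) (N : nat) (p q eta a b gs : 'I_N -> R) (muo : R).
Hypotheses (p0 : forall k, 0 < p k) (q0 : forall k, 0 < q k)
  (eta0 : forall k, 0 < eta k) (a0 : forall k, 0 <= a k)
  (b0 : forall k, 0 <= b k) (gs0 : forall k, 0 <= gs k) (muo0 : 0 < muo).
Variables (x u : nat -> 'I_N -> R).
Hypothesis x0 : forall n k, 0 <= x n k.
Let mu k := q k / p k * muo.
Let S n := \sum_k p k * x n k.
Let D n := \sum_k q k * u n k.
Let B := \sum_k q k * (q k / p k) * b k.
Hypothesis recur : forall n, S n.+1 <= \sum_k p k *
  ((1 - mu k * eta k + mu k ^+ 2 * a k) * x n k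
    - 2 * mu k * u n k + mu k ^+ 2 * b k).
Hypothesis u_ge : forall n k t, 0 < t ->
  (eta k - t^-1) * x n k - t * gs k <= 2 * u n k.

Let S_ge0 n : 0 <= S n.
Proof. by apply: sumr_ge0 => k _; rewrite mulr_ge0 // ltW. Qed.

Let B_ge0 : 0 <= B.
Proof.
apply: sumr_ge0 => k _; rewrite mulr_ge0 // mulr_ge0 ?divr_ge0 //; exact: ltW.
Qed.

Let pmu k : p k * mu k = q k * muo.
Proof. by rewrite /mu; field; rewrite gt_eqF. Qed.

Lemma recursion_rate (rho : R) n :
  (forall k, (1 - mu k * eta k + mu k ^+ 2 * a k) * x n k <= rho * x n k) ->
  S n.+1 <= rho * S n - 2 * muo * D n + muo ^+ 2 * B.
Proof.
move=> rhoP; apply: le_trans (recur n) _.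
rewrite /S /D /B !mulr_sumr -sumrB -big_split /=; apply: ler_sum => k _.
have := ler_wpM2l (ltW (p0 k)) (rhoP k).
have -> : muo ^+ 2 * (q k * (q k / p k) * b k) = p k * mu k * (mu k * b k).
  by rewrite pmu /mu; ring.
have -> : 2 * muo * (q k * u n k) = 2 * (p k * mu k * u n k).
  by rewrite pmu; ring.
lra.
Qed.

Lemma recursion_step_energy n :
  \sum_k p k * (mu k ^+ 2 * (a k * x n k + b k)) <=
    muo ^+ 2 * ((\sum_k (q k / p k) ^+ 2 * a k) * S n + B).
Proof.
rewrite /S mulr_sumr mulrDr [X in X + _]mulr_sumr [X in _ + X]mulr_sumr.
rewrite -big_split /=; apply: ler_sum => k _.
have r0 l : 0 <= (q l / p l) ^+ 2 * a l by rewrite mulr_ge0 // sqr_ge0.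
have H : (q k / p k) ^+ 2 * a k <= \sum_k (q k / p k) ^+ 2 * a k.
  by rewrite (bigD1 k) //= lerDl sumr_ge0.
have px : 0 <= muo ^+ 2 * (p k * x n k).
  by rewrite mulr_ge0 ?sqr_ge0 // mulr_ge0 // ltW.
have := ler_wpM2l px H.
have -> : muo ^+ 2 * (q k * (q k / p k) * b k) =
    p k * (mu k ^+ 2 * b k) by rewrite /mu; field; rewrite gt_eqF.
have -> : muo ^+ 2 * (p k * x n k) * ((q k / p k) ^+ 2 * a k) =
   p k * (mu k ^+ 2 * (a k * x n k)) by rewrite /mu; ring.
lra.
Qed.

(** Half of the decay due to strong convexity survives the growth term, which
    leaves a contraction by [1 - c * muo]. The perturbation is of order [muo] too,
    so that the limit superior is bounded by a constant free of [muo]; this is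
    what allows the disagreement constant to be chosen before the step-size. *)
Lemma recursion_eventually_bounded (c : R) : 0 < c ->
  (forall k, 2 * c <= q k / p k * eta k) ->
  (forall k, mu k * eta k < 1) -> (0 < N)%N ->
  (forall n k, mu k * (a k * x n k) <= eta k / 2 * x n k) ->
  exists n1, forall n, (n1 <= n)%N ->
    S n <= ((\sum_k q k * (gs k / eta k)) + B / (2 * c)) / c + 1.
Proof.
move=> c0 cP mu1 N0 half; set Gs := \sum_k _.
have Gs0 : 0 <= Gs.
  by apply: sumr_ge0 => k _; rewrite mulr_ge0 ?divr_ge0 // ltW.
have cmuo : 2 * c * muo < 1.
  apply: le_lt_trans (mu1 (Ordinal N0)).
  have := ler_wpM2r (ltW muo0) (cP (Ordinal N0)); rewrite /mu; lra.
have step n : S (n + 1)%N <= (1 - c * muo) * S n + (muo * Gs + muo ^+ 2 * B).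
  have H k : (1 - mu k * eta k + mu k ^+ 2 * a k) * x n k <=
      (1 - mu k * eta k / 2) * x n k.
    have mu_ge0 : 0 <= mu k by rewrite mulr_ge0 ?divr_ge0 // ltW.
    by have := ler_wpM2l mu_ge0 (half n k); lra.
  rewrite addn1; apply: le_trans (recur n) _.
  rewrite /S /Gs /B !mulr_sumr -!big_split /=; apply: ler_sum => k _.
  have p_ge0 := ltW (p0 k).
  have := ler_wpM2l p_ge0 (H k).
  have ie : 0 < (eta k)^-1 by rewrite invr_gt0.
  have := u_ge n k ie; rewrite invrK subrr mul0r sub0r => U.
  have qm : 0 <= q k * muo by rewrite mulr_ge0 // ltW.
  have := ler_wpM2l qm U.
  have -> : muo ^+ 2 * (q k * (q k / p k) * b k) = p k * mu k * (mu k * b k).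
    by rewrite pmu /mu; ring.
  have px : 0 <= muo * (p k * x n k).
    by rewrite mulr_ge0 ?(ltW muo0) // mulr_ge0.
  have := ler_wpM2l px (cP k).
  have -> : muo * (p k * x n k) * (q k / p k * eta k) =
    p k * mu k * (eta k * x n k) by rewrite /mu; ring.
  rewrite -[q k * muo]pmu.
  have -> : muo * (q k * (gs k / eta k)) = p k * mu k * ((eta k)^-1 * gs k).
    by rewrite pmu; ring.
  lra.
have rho01 : 0 <= 1 - c * muo < 1.
  have cm0 := mulr_gt0 c0 muo0; apply/andP; split; lra.
have [n1 n1P] := @eventually_le_fixpoint R S 0 0 (1 - c * muo)
  (muo * Gs + muo ^+ 2 * B) 1 rho01 ltr01 (fun n _ => step n).
exists n1 => n /n1P/le_trans; apply; rewrite lerD2r.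
have -> : (muo * Gs + muo ^+ 2 * B) / (1 - (1 - c * muo)) = (Gs + muo * B) / c.
  have -> : 1 - (1 - c * muo) = c * muo by ring.
  field.
  by rewrite (gt_eqF c0) (gt_eqF muo0).
rewrite ler_wpM2r ?invr_ge0 ?(ltW c0) // lerD2l mulrC (ler_wpM2l B_ge0) //.
by rewrite -[(2 * c)^-1]mul1r ler_pdivlMr; [lra|lra].
Qed.

Section Pocket.
Variables (alpha v : R) (i : nat).
Hypotheses (alpha01 : 0 < alpha < 1) (i0 : (0 < i)%N)
  (rate_step : forall n, S n.+1 <= alpha * S n - 2 * muo * D n + muo ^+ 2 * B)
  (v_le : forall j, (0 < j <= i)%N -> v <= D j).

(** If the best gap [v] exceeds [muo * B / 2] by a margin, each step loses that
    margin, which [S >= 0] only allows while [alpha ^+ i] is not small. *)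
Lemma pocket_bound : v <= muo / 2 * B + alpha ^+ i * (S 1 / (2 * muo)).
Proof.
case/andP: alpha01 => al0 al1.
pose delta := 2 * muo * v - muo ^+ 2 * B.
suff H : delta <= alpha ^+ i * S 1.
  have m2 : 0 < 2 * muo by rewrite mulr_gt0.
  rewrite -(ler_pM2l m2).
  have -> : 2 * muo * (muo / 2 * B + alpha ^+ i * (S 1 / (2 * muo))) =
     muo ^+ 2 * B + alpha ^+ i * S 1 by field; rewrite gt_eqF.
  by move: H; rewrite /delta; lra.
have [d0|d0] := leP delta 0.
  by rewrite (le_trans d0) // mulr_ge0 // exprn_ge0 // ltW.
have step j : (0 < j <= i)%N -> S j.+1 <= alpha * S j - delta.
  move=> /v_le vj; apply: le_trans (rate_step j) _.
  have m2 : 0 <= 2 * muo by rewrite mulr_ge0 // ltW.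
  by have := ler_wpM2l m2 vj; rewrite /delta; lra.
have H j : (j < i)%N -> S j.+2 <= alpha ^+ j.+1 * S 1 - delta.
  elim: j => [|j IH] ji; first by rewrite expr1; apply: step.
  apply: le_trans (step j.+2 ji) _.
  have := ler_wpM2l (ltW al0) (IH (ltnW ji)); rewrite (exprS alpha j.+1).
  have : 0 <= alpha * delta by rewrite mulr_ge0 // ltW.
  lra.
move: i0 H; case: i => // j _ /(_ j (leqnn _)).
have := S_ge0 j.+2; lra.
Qed.

(** Started at the minimizer, the exponential term of the bound is zero and
    cannot pay for a transient. But the network is then still close to the
    minimizer after one step, so that the first iterate already has a small
    gap. *)
Lemma pocket_bound_from_optimum : (forall k, x 0 k = 0) -> v <= muo * B.
Proof.
case/andP: alpha01 => al0 al1 xz.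
have S00 : S 0 = 0 by rewrite /S big1 // => k _; rewrite xz mulr0.
have D00 : 0 <= D 0.
  apply: sumr_ge0 => k _; rewrite mulr_ge0 ?(ltW (q0 k)) //.
  rewrite leNgt; apply/negP => u0.
  pose t := - u 0 k / (1 + gs k).
  have g1 : 0 < 1 + gs k by have := gs0 k; lra.
  have t0 : 0 < t by rewrite divr_gt0 // oppr_gt0.
  have := u_ge 0 k t0; rewrite xz mulr0 sub0r.
  have tE : t * (1 + gs k) = - u 0 k by rewrite /t divfK // gt_eqF.
  lra.
have vD : v <= D 1 by apply: v_le; rewrite i0.
have m2 : 0 < 2 * muo by rewrite mulr_gt0.
have := rate_step 0; have := rate_step 1; have := S_ge0 2; rewrite S00.
have : 0 <= (1 - alpha) * S 1 by rewrite mulr_ge0 // subr_ge0 ltW.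
have : 0 <= 2 * muo * D 0 by rewrite mulr_ge0 // ltW.
move=> H1 H2 H3 H4 H5; apply: le_trans vD _.
by rewrite -(ler_pM2l m2); lra.
Qed.

End Pocket.
End Recursion.

(** * Admissible step-sizes and the rate *)

Section Steps.
Variables (R : realType) (N : nat) (p : 'cV[R]_N) (q eta beta e : 'I_N -> R).
Hypotheses (p0 : forall k, 0 < p k 0) (q0 : forall k, 0 < q k)
  (eta0 : forall k, 0 < eta k).

Lemma small_steps_lt (h muo : R) k : 0 <= h ->
  small_steps p q eta beta e h muo ->
  step_size p q muo k * eta k < 1 /\
  muo * (beta k ^+ 2 + e k ^+ 2 + 2 * h * e k ^+ 2) < eta k.
Proof.
move=> h0 /(_ k) /andP[mu0]; rewrite lt_min => /andP[m1 m2].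
split; first by rewrite -ltr_pdivlMr.
move: m2; set den := p k 0 * _ + _.
have [d0|d0] := ltP 0 den.
  rewrite ltr_pdivlMr //; have -> : step_size p q muo k * den =
    q k * (muo * (beta k ^+ 2 + e k ^+ 2 + 2 * h * e k ^+ 2)).
    by rewrite /step_size /den; field; rewrite gt_eqF.
  by rewrite (mulrC (eta k)) ltr_pM2l.
(* Division by zero yields zero, so that a vanishing denominator would leave no
   admissible positive step. *)
have q00 : 0 <= eta k * q k by rewrite mulr_ge0 // ltW.
have : eta k * q k / den <= 0 by rewrite mulr_ge0_le0 // invr_le0.
move: mu0; lra.
Qed.

Lemma rate_ge (h muo : R) k :
  1 - step_size p q muo k *
    (eta k - muo * e k ^+ 2 - muo * beta k ^+ 2 - 2 * muo * h * e k ^+ 2)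
  <= rate p q eta beta e h muo.
Proof. exact: le_bigmax_cond. Qed.

Lemma rate_itv (h muo : R) : (0 < N)%N -> 0 <= h -> 0 < muo ->
  small_steps p q eta beta e h muo -> 0 < rate p q eta beta e h muo < 1.
Proof.
move=> N0 h0 muo0 small; apply/andP; split.
  apply: lt_le_trans (rate_ge h muo (Ordinal N0)).
  have [m1 _] := small_steps_lt (Ordinal N0) h0 small.
  have /andP[mu0 _] := small (Ordinal N0).
  have : 0 <= step_size p q muo (Ordinal N0) * (muo * (e (Ordinal N0) ^+ 2
      + beta (Ordinal N0) ^+ 2 + 2 * h * e (Ordinal N0) ^+ 2)).
    rewrite mulr_ge0 ?(ltW mu0) // mulr_ge0 ?(ltW muo0) //.
    by rewrite !addr_ge0 ?sqr_ge0 // mulr_ge0 ?sqr_ge0 // mulr_ge0.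
  lra.
apply/bigmax_ltP; split => // k _.
have [_ m2] := small_steps_lt k h0 small; have /andP[mu0 _] := small k.
rewrite -subr_gt0 opprB addrC subrK mulr_gt0 //; lra.
Qed.

Lemma rate_bigO (h : R) : (0 < N)%N -> 
  ((fun muo => rate p q eta beta e h muo - 1) : R -> R^o)
      =O_ ((0 : R)^'+) (idfun : R -> R^o).
Proof.
move=> N0.
pose K k := eta k + e k ^+ 2 + beta k ^+ 2 + 2 * `|h| * e k ^+ 2.
have K0 k : 0 <= K k.
  by rewrite !addr_ge0 ?sqr_ge0 ?(ltW (eta0 k)) // mulr_ge0 ?sqr_ge0 // mulr_ge0.
pose C := \sum_k q k / p k 0 * K k.
have r0 k : 0 <= q k / p k 0 by rewrite divr_ge0 // ltW.
have C0 : 0 <= C by apply: sumr_ge0 => k _; rewrite mulr_ge0.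
apply/eqO_exP; exists (C + 1); first by lra.
near=> m.
have m0 : 0 < m by near: m; exact: nbhs_right_gt.
have m1 : m <= 1 by near: m; exact: nbhs_right_le.
have term k : `|step_size p q m k * (eta k - m * e k ^+ 2 - m * beta k ^+ 2
     - 2 * m * h * e k ^+ 2)| <= C * m.
  rewrite normrM (ger0_norm (_ : 0 <= step_size p q m k)); last first.
    by rewrite mulr_ge0 // ltW.
  have H : `|eta k - m * e k ^+ 2 - m * beta k ^+ 2 - 2 * m * h * e k ^+ 2|
      <= K k.
    have me : m * e k ^+ 2 <= e k ^+ 2 by rewrite ler_piMl ?sqr_ge0.
    have mb : m * beta k ^+ 2 <= beta k ^+ 2 by rewrite ler_piMl ?sqr_ge0.
    have me0 : 0 <= m * e k ^+ 2 by rewrite mulr_ge0 ?sqr_ge0 // ltW.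
    have mb0 : 0 <= m * beta k ^+ 2 by rewrite mulr_ge0 ?sqr_ge0 // ltW.
    have mh : `|h * (m * e k ^+ 2)| <= `|h| * e k ^+ 2.
      by rewrite normrM ler_wpM2l // ger0_norm.
    move: mh; rewrite ler_norml => mh; have := eta0 k.
    rewrite /K ler_norml; lra.
  apply: le_trans (ler_wpM2l _ H) _; first by rewrite mulr_ge0 // ltW.
  rewrite /step_size mulrAC ler_wpM2r ?(ltW m0) //.
  by rewrite /C (bigD1 k) //= lerDl sumr_ge0 // => l _; rewrite mulr_ge0.
have Cm : 0 <= C * m by rewrite mulr_ge0 // ltW.
rewrite /= (ger0_norm (ltW m0)) ler_norml; apply/andP; split.
  have := rate_ge h m (Ordinal N0); have := term (Ordinal N0).
  rewrite ler_norml; lra.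
suff : rate p q eta beta e h m <= 1 + C * m by lra.
apply/bigmax_leP; split=> [|k _]; first by lra.
by have := term k; rewrite ler_norml; lra.
Unshelve. all: by end_near.
Qed.

End Steps.

(** * Choice of the disagreement constant *)

Theorem theorem1 (R : realType) (N M : nat)
  (d dX dY : measure_display) (Omega : measurableType d)
  (P : probability Omega R)
  (* network, combination weights, step-size weights *)
  (nbh : 'I_N -> {set 'I_N}) (A : 'M[R]_N) (p : 'cV[R]_N) (q : 'I_N -> R)
  (hA : left_stochastic nbh A) (hconn : strongly_connected A)
  (hp : perron_vector A p)
  (hq : forall k, 0 < q k) (hq1 : \sum_(k < N) q k = 1)
  (* risks *)
  (X : 'I_N -> measurableType dX) (x : forall k, {RV P >-> X k})
  (Q : forall k, 'cV[R]_M -> X k -> R)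
  (hQ : forall k (z : X k), convex_function setT (fun w : 'cV[R]_M => Q k w z))
  (hQint : forall k w,
     P.-integrable setT (EFin \o (fun omega => Q k w (x k omega))))
  (J : 'I_N -> 'cV[R]_M -> R)
  (hJ : forall k w, (J k w)%:E = 'E_P[fun omega => Q k w (x k omega)]%E)
  (eta e f : 'I_N -> R) (heta : forall k, 0 < eta k)
  (hsc : forall k, strongly_convex (J k) (eta k))
  (hal : forall k, affine_lipschitz (J k) (e k) (f k))
  (* minimizer and subgradients at it *)
  (wstar : 'cV[R]_M)
  (hw : is_unique_minimizer (fun w => \sum_(k < N) q k * J k w) wstar)
  (gstar : 'I_N -> 'cV[R]_M)
  (hgstar : forall k, subdifferential (J k) wstar (gstar k))
  (hgstar0 : \sum_(k < N) q k *: gstar k = 0)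
  (* true subgradients, streaming observations, approximate subgradients *)
  (g : 'I_N -> 'cV[R]_M -> 'cV[R]_M)
  (hg : forall k w, subdifferential (J k) w (g k w))
  (Y : 'I_N -> measurableType dY) (y : forall k, nat -> {RV P >-> Y k})
  (ghat : forall k, 'cV[R]_M -> Y k -> 'cV[R]_M)
  (hghat : forall k, measurable_fun setT
     (fun u : mvec R M * Y k => ghat k u.1 u.2 : mvec R M))
  (beta sigma : 'I_N -> R)
  (hind : independent_across_agents P (gradient_noise ghat g y))
  (* initial iterates *)
  (w0 : 'I_N -> Omega -> 'cV[R]_M)
  (hw0 : forall k, measurable_fun setT (w0 k : Omega -> mvec R M))
  (hw02 : forall k,
     ('E_P[fun omega => (enorm (w0 k omega - wstar) ^+ 2)%R] < +oo)%E) :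
  exists2 h : R, 0 <= h &
    ((fun muo => rate p q eta beta e h muo - 1) : R -> R^o)
      =O_ ((0 : R)^'+) (idfun : R -> R^o) /\
    forall muo : R, 0 < muo ->
      let w := diffusion nbh A (step_size p q muo) ghat y w0 in
      let alpha := rate p q eta beta e h muo in
      noise_moments P (gradient_noise ghat g y) w wstar beta sigma ->
      small_steps p q eta beta e h muo ->
      [/\ exists Io : nat, forall i k, (Io <= i)%N ->
            ('E_P[fun omega =>
                (enorm (\sum_(l < N) p l 0 *: (wstar - w i.-1 l omega)
                       - (wstar - w i.-1 k omega)) ^+ 2)%R]
              <= (h ^+ 2 * muo ^+ 2)%:E)%E,
          0 < alpha < 1 &
          forall best : 'I_N -> nat -> nat, is_best_pocket P J w best ->
          exists xi : R, forall i : nat, (1 <= i)%N ->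
            ('E_P[fun omega =>
                (\sum_(k < N) q k * J k (w (best k i) k omega)
                 - \sum_(k < N) q k * J k wstar)%R]
             <= (xi * alpha ^+ i)%:E *
                  \sum_(k < N) (q k)%:E *
                    'E_P[fun omega => (enorm (w0 k omega - wstar) ^+ 2)%R]
                + (muo / 2 * \sum_(k < N)
                     (q k * f k ^+ 2 + q k * sigma k ^+ 2
                      + 2 * h * q k *
                        (f k ^+ 2 + enorm (gstar k) ^+ 2 + 2^-1)))%:E)%E].
Proof.
have [Ap p0 p1] := hp; have [_ A0 A1 _] := hA.
have N0 : (0 < N)%N.
  rewrite lt0n; apply/eqP => N0; move: hq1; rewrite big1; first by lra.
  by move=> k; have := ltn_ord k; rewrite [X in (_ < X)%N]N0.
pose r k := q k / p k 0.
have r0 k : 0 < r k by rewrite divr_gt0.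
pose a := growth e beta; pose b := offset f gstar sigma.
pose gs k := sqn (gstar k).
have a0 k : 0 <= a k by rewrite addr_ge0 // mulr_ge0 ?sqr_ge0.
have b0 k : 0 <= b k by rewrite !addr_ge0 // mulr_ge0 ?sqr_ge0 ?sqn_ge0.
have gs0 k : 0 <= gs k by exact: sqn_ge0.
have [m [eps e01 epsP]] := doeblin_minorization A0 hconn p0 p1.
have eps0 : 0 < eps by case/andP: e01.
have [c /andP[c0 _] cP] := @pos_lower_bound R _ (fun k => r k * eta k / 2)
  (fun k => divr_gt0 (mulr_gt0 (r0 k) (heta k)) (@ltr0Sn R 1)).
pose B := \sum_k q k * r k * b k.
have B0 : 0 <= B.
  by apply: sumr_ge0 => k _; rewrite mulr_ge0 // mulr_ge0 // ltW.
pose K := \sum_k r k ^+ 2 * a k.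
have K0 : 0 <= K by apply: sumr_ge0 => k _; rewrite mulr_ge0 // sqr_ge0.
pose Smax := ((\sum_k q k * (gs k / eta k)) + B / (2 * c)) / c + 1.
pose Gmax := K * Smax + B.
have S0 : 0 <= Smax.
  rewrite addr_ge0 // divr_ge0 ?(ltW c0) // addr_ge0 //.
    by apply: sumr_ge0 => k _; rewrite mulr_ge0 ?divr_ge0 // ltW.
  by rewrite divr_ge0 // mulr_ge0 // ltW.
have G0 : 0 <= Gmax by rewrite addr_ge0 // mulr_ge0.
pose Dmax := (2 / eps * (2 ^+ m.+2 * Gmax)) / eps + 1.
have D0 : 0 <= Dmax.
  rewrite addr_ge0 // divr_ge0 ?(ltW eps0) // mulr_ge0 ?divr_ge0 ?(ltW eps0) //.
  by rewrite mulr_ge0 // exprn_ge0.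
(* The second summand makes the step-size condition absorb [growth], the third
   makes the residual absorb [offset], and the last dominates the disagreement
   relative to every [p k 0]. *)
pose h := 1 + \sum_k r k * a k / eta k ^+ 2 + 2 * B + \sum_k Dmax / p k 0.
have h1s k : 0 <= r k * a k / eta k ^+ 2.
  by rewrite divr_ge0 ?sqr_ge0 // mulr_ge0 // ltW.
have h2s k : 0 <= Dmax / p k 0 by rewrite divr_ge0 // ltW.
have h1 : 0 <= \sum_k r k * a k / eta k ^+ 2 by rewrite sumr_ge0.
have h2 : 0 <= \sum_k Dmax / p k 0 by rewrite sumr_ge0.
have h_ge1 : 1 <= h by rewrite /h; lra.
have h_ge0 : 0 <= h by lra.
have h_growth k : r k * a k <= h * eta k ^+ 2.
  have le1 : r k * a k / eta k ^+ 2 <= \sum_k r k * a k / eta k ^+ 2.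
    by rewrite (bigD1 k) //= lerDl sumr_ge0.
  by rewrite -ler_pdivrMr ?exprn_gt0 // (le_trans le1) // /h; lra.
have h_offset : 2 * B <= h by rewrite /h; lra.
have h_dev k : Dmax <= p k 0 * h ^+ 2.
  rewrite mulrC -ler_pdivrMr //.
  have : Dmax / p k 0 <= h.
    have : Dmax / p k 0 <= \sum_k Dmax / p k 0.
      by rewrite (bigD1 k) //= lerDl sumr_ge0.
    by rewrite /h; lra.
  by move=> /le_trans; apply; rewrite expr2 ler_peMl.
exists h => //; split; first exact: rate_bigO.
move=> muo muo0 w alpha hn small.
have mu_gt0 k : 0 < step_size p q muo k by case/andP: (small k).
have alpha01 : 0 < alpha < 1 by exact: rate_itv.
pose err n k := msd (P := P) nbh A wstar y ghat w0 (step_size p q muo) n k.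
pose u n k := mean_gap (P := P) nbh A J wstar y ghat w0 (step_size p q muo) n k.
have err0 n k : 0 <= err n k by exact: msd_ge0.
have recur n := total_msd_step hA hp heta hsc hal hgstar hg hghat hw0 hw02
  mu_gt0 hn n.
have u_ge n k t (t0 : 0 < t) := mean_gap_ge hA heta hsc hal hgstar hg hghat
  hw0 hw02 hn n k t0.
have err_eta n k : eta k ^+ 2 * err n k <= e k ^+ 2 * err n k.
  exact: (msd_eta_le hA heta hsc hal hgstar hg hghat hw0 hw02 hn n k).
(* [e k] dominates [eta k] wherever the error does not vanish, so that the term
   [h * e k ^+ 2] of the rate is large enough to cover the growth. *)
have absorb n k : r k * a k * err n k <= h * e k ^+ 2 * err n k.
  apply: le_trans (ler_wpM2r (err0 n k) (h_growth k)) _.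
  by have := ler_wpM2l h_ge0 (err_eta n k); lra.
have steps k := small_steps_lt p0 hq heta k h_ge0 small.
have half n k : step_size p q muo k * (a k * err n k) <= eta k / 2 * err n k.
  have [_ m2] := steps k.
  have := ler_wpM2l (ltW muo0) (absorb n k).
  have {m2} := ler_wpM2r (err0 n k) (ltW m2).
  have : 0 <= muo * (beta k ^+ 2 + e k ^+ 2) * err n k.
    by rewrite mulr_ge0 // mulr_ge0 ?(ltW muo0) // addr_ge0 ?sqr_ge0.
  rewrite /step_size -/(r k); lra.
have rate_step n : \sum_k p k 0 * err n.+1 k <= alpha * (\sum_k p k 0 * err n k)
    - 2 * muo * (\sum_k q k * u n k) + muo ^+ 2 * B.
  apply: (recursion_rate (p := fun k => p k 0) p0 recur) => k.
  change ((1 - step_size p q muo k * eta k + step_size p q muo k ^+ 2 * a k)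
    * err n k <= alpha * err n k).
  have := ler_wpM2r (err0 n k) (rate_ge p q eta beta e h muo k).
  have mm : 0 <= step_size p q muo k * muo by rewrite mulr_ge0 // ltW.
  have := ler_wpM2l mm (absorb n k).
  have : 0 <= step_size p q muo k * muo * (e k ^+ 2 + beta k ^+ 2
      + h * e k ^+ 2) * err n k.
    by rewrite mulr_ge0 // mulr_ge0 // !addr_ge0 ?sqr_ge0 // mulr_ge0 ?sqr_ge0.
  rewrite -/alpha.
  have -> : step_size p q muo k * muo * (r k * a k * err n k) =
    step_size p q muo k ^+ 2 * a k * err n k by rewrite /step_size /r; ring.
  lra.
split=> //.
  have [n1 n1P] := recursion_eventually_bounded (p := fun k => p k 0) p0 hq heta
    b0 gs0 muo0 err0 recur u_ge c0
    (fun k => ltac:(have := cP k; rewrite /r; lra)) (fun k => proj1 (steps k))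
    N0 half.
  have energyP i : (n1 <= i)%N -> step_energy (P := P) nbh A p e f wstar gstar
      y ghat beta sigma w0 (step_size p q muo) i <= muo ^+ 2 * Gmax.
    move=> /n1P Si; apply: le_trans (recursion_step_energy q b muo
      (p := fun k => p k 0) p0 a0 err0 i) _.
    by rewrite ler_wpM2l ?sqr_ge0 // lerD2r ler_wpM2l.
  have Gm : 0 <= muo ^+ 2 * Gmax by rewrite mulr_ge0 ?sqr_ge0.
  have eps1 : 0 <= 1 - eps < 1 by case/andP: e01 => *; apply/andP; split; lra.
  have [n2 n2P] := eventually_le_fixpoint eps1 (exprn_gt0 2 muo0)
    (fun n (n1n : (n1 <= n)%N) => disagreement_step hA hp hal hgstar hg hghat
      hw0 hw02 hn e01 epsP (fun i ni => energyP i (leq_trans n1n ni)) Gm).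
  (* The bound is on the iterates at time [i.-1]. *)
  exists n2.+1 => i k; case: i => // i /n2P Di.
  have dE : (fun omega => enorm (\sum_(l < N) p l 0 *: (wstar - w i l omega)
      - (wstar - w i k omega)) ^+ 2) =
      (fun omega => sqn (deviation p (fun l => w i l omega) k)).
    by apply/funext => omega; rewrite enorm_sqr deviation_shift // sqnN.
  have [_ id] := deviation_sq_int p hA hal hgstar hg hghat hw0 hw02 hn i k.
  rewrite dE expectation_mean // lee_fin.
  have dev := mean_deviation_le hA hp hal hgstar hg hghat hw0 hw02 hn i k.
  have DE : (2 / eps * (2 ^+ m.+2 * (muo ^+ 2 * Gmax))) / (1 - (1 - eps))
      + muo ^+ 2 = muo ^+ 2 * Dmax.
    have -> : 1 - (1 - eps) = eps by ring.
    by rewrite /Dmax; field; rewrite gt_eqF.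
  rewrite DE in Di; rewrite -(ler_pM2l (p0 k)).
  apply: le_trans dev _; apply: le_trans Di _.
  by have := ler_wpM2l (sqr_ge0 muo) (h_dev k); lra.
move=> best hbest.
pose v i := \sum_k q k * u (best k i) k.
have igap n k := gap_rv_int hA heta hsc hal hgstar hg hghat hw0 hw02 hn n k.
have meanJ n k : 'E_P[fun omega => J k (w n k omega)]%E =
    (u n k + J k wstar)%:E.
  have JE : (fun omega => J k (w n k omega)) = (fun omega =>
      gap (P := P) nbh A J wstar y ghat w0 (step_size p q muo) n k omega
      + J k wstar).
    by apply/funext => omega; rewrite subrK.
  have iC := rv_int_cst P (J k wstar).
  rewrite JE expectation_mean; last exact: rv_intD.
  by congr EFin; rewrite meanD // mean_cst.
have v_le i j : (0 < j <= i)%N -> v i <= \sum_k q k * u j k.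
  move=> ji; apply: ler_sum => k _; rewrite ler_wpM2l ?(ltW (hq k)) //.
  have i0 : (0 < i)%N by case/andP: ji => /leq_trans; apply.
  have [_ /(_ j ji)] := hbest k i i0.
  by rewrite !meanJ lee_fin lerD2r.
have vE i : 'E_P[fun omega => (\sum_(k < N) q k * J k (w (best k i) k omega)
    - \sum_(k < N) q k * J k wstar)%R]%E = (v i)%:E.
  have -> : (fun omega => \sum_(k < N) q k * J k (w (best k i) k omega)
      - \sum_(k < N) q k * J k wstar) = (fun omega => \sum_k q k *
      gap (P := P) nbh A J wstar y ghat w0 (step_size p q muo) (best k i) k
        omega).
    apply/funext => omega; rewrite -sumrB; apply: eq_bigr => k _.
    by rewrite -mulrBr.
  have iq k : rv_int P (fun omega => q k *
      gap (P := P) nbh A J wstar y ghat w0 (step_size p q muo) (best k i) k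
        omega) by exact: rv_intZ.
  rewrite expectation_mean; last exact: rv_int_sum.
  by rewrite mean_sum //; congr EFin; apply: eq_bigr => k _; rewrite meanZ.
have w0E : (\sum_(k < N) (q k)%:E *
    'E_P[fun omega => (enorm (w0 k omega - wstar) ^+ 2)%R])%E =
    (\sum_k q k * err 0%N k)%:E.
  rewrite -sumEFin; apply: eq_bigr => k _; rewrite EFinM; congr (_ * _)%E.
  have [_ iw] := iterate_error_sq_int hA hal hgstar hg hghat hw0 hw02 hn 0 k.
  rewrite -expectation_mean //; congr (expectation _ _).
  by apply/funext => omega; rewrite enorm_sqr.
set C := \sum_(k < N) (q k * f k ^+ 2 + _ + _).
have CB : 2 * B <= C.
  apply: le_trans h_offset _; rewrite -[h]mulr1 -hq1 mulr_sumr.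
  apply: ler_sum => k _; rewrite enorm_sqr.
  have qf : 0 <= q k * f k ^+ 2 by rewrite mulr_ge0 ?sqr_ge0 // ltW.
  have qs : 0 <= q k * sigma k ^+ 2 by rewrite mulr_ge0 ?sqr_ge0 // ltW.
  have hqf : 0 <= h * q k * (f k ^+ 2 + gs k).
    by rewrite mulr_ge0 ?addr_ge0 ?sqr_ge0 // mulr_ge0 // ltW.
  rewrite -/(gs k); lra.
have muC : muo * B <= muo / 2 * C.
  by have := ler_wpM2l (ltW muo0) CB; lra.
have mB : muo / 2 * B <= muo * B.
  by have := mulr_ge0 (ltW muo0) B0; lra.
pose W := \sum_k q k * err 0%N k.
have W0 : 0 <= W by apply: sumr_ge0 => k _; rewrite mulr_ge0 // ltW.
have [Wz|Wnz] := eqVneq W 0.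
  exists 0 => i i0; rewrite vE w0E mul0r mul0e add0e lee_fin.
  apply: le_trans muC; apply: (pocket_bound_from_optimum
    (p := fun k => p k 0) p0 hq gs0 muo0 err0 u_ge alpha01 i0 rate_step (v_le i)).
  move=> k; have qx l : true -> 0 <= q l * err 0%N l.
    by rewrite mulr_ge0 // ltW.
  have /(_ k isT)/eqP := psumr_eq0P qx Wz.
  by rewrite mulf_eq0 (gt_eqF (hq k)) => /eqP.
exists ((\sum_k p k 0 * err 1%N k) / (2 * muo) / W) => i i0.
rewrite vE w0E -EFinM -EFinD lee_fin.
have bound := pocket_bound (p := fun k => p k 0) p0 muo0 err0 alpha01 i0
  rate_step (v_le i).
rewrite mulrAC divfK // mulrC; apply: le_trans bound _.
rewrite addrC lerD2l; exact: le_trans mB muC.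
Qed.
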